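(* Any OT-manifold $X(K,U)$ can be endowed with an LCP structure.
   Context: OT-manifolds. Let $K$ be a number field with $s>0$ real embeddings $\sigma_1,\ldots,\sigma_s$ and $2t>0$ nonreal complex embeddings $\sigma_{s+1},\ldots,\sigma_{s+2t}$, where $\sigma_{s+i}$ and $\sigma_{s+t+i}$ are complex conjugate for $1\le i\le t$. Let $\sigma:K\to\mathbb{C}^{s+t}$, $a\mapsto(\sigma_1(a),\ldots,\sigma_{s+t}(a))$. Let $\mathcal O_K$ be the ring of integers of $K$ and $\mathcal O_K^{\times,+}:=\{a\in\mathcal O_K^\times:\sigma_i(a)>0,\ 1\le i\le s\}$. The group $\mathcal O_K$ acts on $\mathbb{C}^{s+t}$ by translations $z\mapsto z+\sigma(a)$, and $\mathcal O_K^{\times,+}$ acts by $az:=(\sigma_1(a)z_1,\ldots,\sigma_{s+t}(a)z_{s+t})$. Let $\ell:\mathcal O_K^{\times,+}\to\mathbb{R}^{s+t}$, $\ell(u):=(\ln|\sigma_1(u)|,\ldots,\ln|\sigma_s(u)|,2\ln|\sigma_{s+1}(u)|,\ldots,2\ln|\sigma_{s+t}(u)|)$, and let $p_{\mathbb{R}^s}:\mathbb{R}^{s+t}\to\mathbb{R}^s$ be the projection on the first $s$ coordinates. Let $U$ be a subgroup of $\mathcal O_K^{\times,+}$ such that $p_{\mathbb{R}^s}\circ\ell(U)$ is a full lattice (discrete cocompact subgroup) of $\mathbb{R}^s$. With $H:=\{z\in\mathbb{C}:\mathrm{Im}(z)>0\}$, the group $U\ltimes\mathcal O_K$ acts freely,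 properly and cocompactly on $H^s\times\mathbb{C}^t$, and the OT-manifold is the compact manifold $X(K,U):=(H^s\times\mathbb{C}^t)/(U\ltimes\mathcal O_K)$. Weyl structures. A Weyl structure on a conformal manifold $(M,c)$ is a torsion-free connection $D$ on $TM$ such that for every $g\in c$ there is a $1$-form $\theta_g$ (the Lee form) with $Dg=-2\theta_g\otimes g$. It is closed (resp. exact) if $\theta_g$ is closed (resp. exact) for one, equivalently all, $g\in c$. If $D$ is closed, its lift to the universal cover $\widetilde M$ is the Levi-Civita connection of a metric $h_D$ in the lifted conformal class, unique up to a positive constant factor, and $\pi_1(M)$ acts on $(\widetilde M,h_D)$ by similarities (diffeomorphisms $s$ with $s^*h_D=\lambda^2h_D$ for some constant $\lambda>0$). LCP structures. An LCP (locally conformally product) structure on a compact manifold $M$ is a conformal class $c$ together with a closed, non-exact Weyl structure $D$ with reducible, non-flat holonomy. By a theorem of Kourganoff, one then has $(\widetilde M,h_D)=\mathbb{R}^q\times(N,g_N)$ (Riemannian product), where $q\ge1$, $\mathbb{R}^q$ is Euclidean space and $(N,g_N)$ is a non-flat, non-complete Riemannian manifold with irreducible holonomy. *)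

(* Defs.v *)
From HB Require Import structures.
From mathcomp Require Import all_boot all_order all_algebra all_field.
From mathcomp Require Import generic_quotient complex.
From mathcomp Require Import all_classical all_reals all_analysis.

Set Implicit Arguments.
Unset Strict Implicit.
Unset Printing Implicit Defensive.

Import Order.TTheory GRing.Theory Num.Theory.
Import numFieldNormedType.Exports.

Local Open Scope classical_set_scope.
Local Open Scope ring_scope.
Local Open Scope complex_scope.
Local Open Scope quotient_scope.

Section OrbitSpace.
Variables (T : topologicalType) (orb : T -> set T).

Definition same_orbit : rel T := fun x y => `[< orb x = orb y >].

Lemma same_orbit_equiv : equiv_class_of same_orbit.
Proof.
split.
- by move=> x; apply/asboolP.
- by move=> x y; apply/asboolP/asboolP.
- by move=> y x z /asboolP xy /asboolP yz; apply/asboolP; rewrite xy.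
Qed.

Definition same_orbit_eqv : equiv_rel T := EquivRelPack same_orbit_equiv.

Definition orbit_space : Type := quotient_topology {eq_quot same_orbit_eqv}.

HB.instance Definition _ := Topological.copy orbit_space
  (quotient_topology {eq_quot same_orbit_eqv}).

Definition orbit_proj (x : T) : orbit_space :=
  \pi_{eq_quot same_orbit_eqv} x.

End OrbitSpace.

Section Smooth.
Variables (R : realType) (n : nat).

Definition partial (W : normedModType R) (i : 'I_n) (f : 'rV[R]_n -> W) :
  'rV[R]_n -> W := fun v => 'D_(delta_mx 0 i) f v.

(* C^infinity on A, for A open: all iterated partial derivatives exist and are
   differentiable at every point of A. *)
Definition smooth_on (A : set 'rV[R]_n) (f : 'rV[R]_n -> R) : Prop :=
  forall (l : seq 'I_n) v, A v ->
    differentiable (foldr (@partial R) f l) v.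

Variable M : topologicalType.

(* A homeomorphism cmap between the open sets cdom and ccod, with inverse cinv;
   the values of cmap off cdom and of cinv off ccod are irrelevant. *)
Record chart := Chart {
  cdom : set M;
  ccod : set 'rV[R]_n;
  cmap : M -> 'rV[R]_n;
  cinv : 'rV[R]_n -> M;
  cdom_open : open cdom;
  ccod_open : open ccod;
  cmap_cod : forall x, cdom x -> ccod (cmap x);
  cinv_dom : forall v, ccod v -> cdom (cinv v);
  cmapK : forall x, cdom x -> cinv (cmap x) = x;
  cinvK : forall v, ccod v -> cmap (cinv v) = v;
  cmap_continuous : {within cdom, continuous cmap};
  cinv_continuous : {within ccod, continuous cinv} }.

Definition transition (c c' : chart) : 'rV[R]_n -> 'rV[R]_n :=
  cmap c' \o cinv c.

Definition overlap (c c' : chart) : set 'rV[R]_n :=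
  [set v | ccod c v /\ cdom c' (cinv c v)].

Variable A : set chart.

Definition smooth_atlas : Prop :=
  (forall x : M, exists2 c, A c & cdom c x) /\
  (forall c c', A c -> A c' -> forall k : 'I_n,
     smooth_on (overlap c c') (fun v => transition c c' v 0 k)).

(* Second countability is automatic for a compact locally Euclidean space. *)
Definition compact_manifold : Prop :=
  [/\ smooth_atlas, hausdorff_space M, connected [set: M]
    & compact [set: M] ].

Definition smooth_fun (f : M -> R) : Prop :=
  forall c, A c -> smooth_on (ccod c) (f \o cinv c).

(* Tensors and connections are given by their components in each chart of the
   atlas, subject to the transformation rule under changes of charts.
   Tangent vectors are row vectors: with J := 'J (transition c c') v, a vector
   with components Y in c has components Y *m J in c', and
   J a b is the a-th partial derivative of the b-th component. *)

Definition one_form := chart -> 'rV[R]_n -> 'cV[R]_n.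

Definition is_one_form (theta : one_form) : Prop :=
  (forall c, A c -> forall i,
     smooth_on (ccod c) (fun v => theta c v i 0)) /\
  (forall c c' v, A c -> A c' -> overlap c c' v ->
     theta c v = 'J (transition c c') v *m theta c' (transition c c' v)).

Definition closed_form (theta : one_form) : Prop :=
  forall c v i j, A c -> ccod c v ->
    partial i (fun w => theta c w j 0) v
    = partial j (fun w => theta c w i 0) v.

Definition exact_form (theta : one_form) : Prop :=
  exists2 f : M -> R, smooth_fun f &
    forall c v i, A c -> ccod c v ->
      theta c v i 0 = partial i (f \o cinv c) v.

Definition metric := chart -> 'rV[R]_n -> 'M[R]_n.

Definition is_riemannian (g : metric) : Prop :=
  [/\ forall c, A c -> forall i j, smooth_on (ccod c) (fun v => g c v i j),
      forall c v, A c -> ccod c v -> (g c v)^T = g c v,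
      forall c v (Y : 'rV[R]_n), A c -> ccod c v -> Y != 0 ->
        0 < (Y *m g c v *m Y^T) 0 0
    & forall c c' v, A c -> A c' -> overlap c c' v ->
        let J := 'J (transition c c') v in
        g c v = J *m g c' (transition c c' v) *m J^T ].

Definition conformal (g0 g : metric) : Prop :=
  exists2 f : M -> R, smooth_fun f &
    forall c v, A c -> ccod c v ->
      g c v = expR (2 * f (cinv c v)) *: g0 c v.

Definition is_conformal_class (C : set metric) : Prop :=
  exists2 g0, is_riemannian g0 &
    C = [set g | is_riemannian g /\ conformal g0 g].

(* D c v i is the matrix with (j, k) entry the Christoffel symbol
   Gamma_{ij}^k: the derivative of a vector field Y along the i-th
   coordinate field is partial i Y + Y *m D c v i. *)
Definition connection := chart -> 'rV[R]_n -> 'I_n -> 'M[R]_n.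

Definition is_connection (D : connection) : Prop :=
  (forall c, A c -> forall i j k,
     smooth_on (ccod c) (fun v => D c v i j k)) /\
  (forall c c' v i, A c -> A c' -> overlap c c' v ->
     let J := jacobian (transition c c') in
     D c v i *m J v = partial i J v
       + J v *m \sum_a (J v i a *: D c' (transition c c' v) a)).

Definition torsion_free (D : connection) : Prop :=
  forall c v i j k, A c -> ccod c v -> D c v i j k = D c v j i k.

(* D g = - 2 theta \otimes g *)
Definition lee_form (D : connection) (g : metric) (theta : one_form) : Prop :=
  is_one_form theta /\
  forall c v i, A c -> ccod c v ->
    partial i (g c) v - D c v i *m g c v - g c v *m (D c v i)^T
    = - (2 * theta c v i 0) *: g c v.

Definition weyl_structure (C : set metric) (D : connection) : Prop :=
  [/\ is_connection D, torsion_free D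
    & forall g, C g -> exists theta, lee_form D g theta ].

Definition closed_weyl (C : set metric) (D : connection) : Prop :=
  exists g theta, [/\ C g, lee_form D g theta & closed_form theta].

Definition exact_weyl (C : set metric) (D : connection) : Prop :=
  exists g theta, [/\ C g, lee_form D g theta & exact_form theta].

Definition curvature (D : connection) c v (i j : 'I_n) : 'M[R]_n :=
  partial i (fun w => D c w j) v - partial j (fun w => D c w i) v
  + D c v j *m D c v i - D c v i *m D c v j.

Definition flat (D : connection) : Prop :=
  forall c v i j, A c -> ccod c v -> curvature D c v i j = 0.

(* transport D c v c' v' P: Y |-> Y *m P is the parallel transport of D along
   some piecewise smooth curve from the point with coordinates v in c to the
   point with coordinates v' in c', source and target vectors being expressed
   in c and c' respectively.  Such a curve is a concatenation of finitely many
   smooth curves, each lying in one chart. *)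
Inductive transport (D : connection) :
  chart -> 'rV[R]_n -> chart -> 'rV[R]_n -> 'M[R]_n -> Prop :=
| TransportChart c c' v : A c -> A c' -> overlap c c' v ->
    transport D c v c' (transition c c' v) ('J (transition c c') v)
| TransportSegment c (gamma : R -> 'rV[R]_n) (P : R -> 'M[R]_n) :
    A c ->
    (forall k (t : R), derivable (derive1n k gamma) t 1) ->
    (forall t : R, 0 <= t <= 1 -> ccod c (gamma t)) ->
    P 0 = 1%:M ->
    (forall t : R, 0 <= t <= 1 ->
       is_derive t 1 P
         (- (P t *m \sum_i (derive1 gamma t 0 i *: D c (gamma t) i)))) ->
    transport D c (gamma 0) c (gamma 1) (P 1)
| TransportComp c v c' v' c'' v'' P Q :
    transport D c v c' v' P -> transport D c' v' c'' v'' Q ->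
    transport D c v c'' v'' (P *m Q).

(* The full holonomy group at the point with coordinates v in c. *)
Definition holonomy (D : connection) (c : chart) (v : 'rV[R]_n) :
  set 'M[R]_n := [set P | transport D c v c v P].

Definition reducible (D : connection) : Prop :=
  forall c v, A c -> ccod c v ->
    exists W : 'M[R]_n, (0 < \rank W < n)%N /\
      forall P, holonomy D c v P -> stablemx W P.

Definition lcp_structure (C : set metric) (D : connection) : Prop :=
  [/\ compact_manifold, is_conformal_class C, weyl_structure C D,
      closed_weyl C D & ~ exact_weyl C D] /\ reducible D /\ ~ flat D.

End Smooth.

Definition full_lattice (R : realType) (s : nat) (L : set 'rV[R]_s) : Prop :=
  [/\ L 0, forall x y, L x -> L y -> L (x - y),
      L `<=` isolated L
    & compact [set: orbit_space (fun x : 'rV[R]_s => [set x + l | l in L])] ].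

Definition integer (K : fieldExtType rat) (a : K) : Prop :=
  integralOver (intr : int -> K) a.

Section OT.
Variables (R : realType) (K : fieldExtType rat) (s t : nat).
Variable sigma : 'I_(s + t + t) -> {rmorphism K -> R[i]}.

(* sigma lists all the embeddings of K once: s real ones, then t nonreal ones,
   then the conjugates of these. *)
Definition lists_embeddings : Prop :=
  [/\ forall tau : {rmorphism K -> R[i]}, exists! i, sigma i =1 tau,
      forall (i : 'I_s) a, complex.Im (sigma (lshift t (lshift t i)) a) = 0,
      forall j : 'I_t,
        exists a, complex.Im (sigma (lshift t (rshift s j)) a) != 0
    & forall (j : 'I_t) a,
        sigma (rshift (s + t) j) a = (sigma (lshift t (rshift s j)) a)^* ].

Definition positive_unit (a : K) : Prop :=
  [/\ a != 0, integer a, integer a^-1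
    & forall i : 'I_s, 0 < sigma (lshift t (lshift t i)) a].

Definition ell (u : K) : 'rV[R]_(s + t) :=
  row_mx (\row_(i < s) ln (complex.Re `|sigma (lshift t (lshift t i)) u|))
    (\row_(j < t) (2 * ln (complex.Re `|sigma (lshift t (rshift s j)) u|))).

Definition admissible (U : set K) : Prop :=
  [/\ U `<=` positive_unit, U 1,
      forall u v, U u -> U v -> U (u * v),
      forall u, U u -> U u^-1
    & full_lattice [set lsubmx (ell u) | u in U] ].

(* C^(s+t) is identified with R^(2(s+t)) by the real parts of all the
   coordinates followed by their imaginary parts. *)
Definition zcoord (v : 'rV[R]_(s + t + (s + t))) (i : 'I_(s + t)) : R[i] :=
  v 0 (lshift (s + t) i) +i* v 0 (rshift (s + t) i).

Definition HsCt : set 'rV[R]_(s + t + (s + t)) :=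
  [set v | forall i : 'I_s, 0 < complex.Im (zcoord v (lshift t i))].

Variable U : set K.

Definition OT_orbit (z : HsCt) : set HsCt :=
  [set w | exists u a, [/\ U u, integer a
    & forall i, zcoord (set_val w) i
        = sigma (lshift t i) u * zcoord (set_val z) i
          + sigma (lshift t i) a] ].

Definition OT : topologicalType := orbit_space OT_orbit.

(* The local inverses of the projection from H^s x C^t. *)
Definition OT_atlas : set (chart R (s + t + (s + t)) OT) :=
  [set c | ccod c `<=` HsCt /\
    forall z : HsCt, ccod c (set_val z) ->
      cinv c (set_val z) = orbit_proj OT_orbit z].

End OT.

Arguments OT_atlas {R K s t} sigma U.

(* Main.v *)
(* For u in U, each ln |sigma_(s+j)(u)| is a linear form a_j in the vector
   (ln sigma_1(u), .., ln sigma_s(u)), because these vectors form a full lattice.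
   Writing y for the imaginary parts of the first s coordinates, the metric
     g = sum_i |dz_i|^2 / y_i^2 + sum_j exp (- 2 a_j . ln y) |dz_(s+j)|^2
   is invariant under the group. Since a unit has norm 1 or -1,
     sum_i e_i + 2 sum_j a_j = 0,
   so that some a := a_j0 has a negative coordinate a_p. The group acts on
   h = exp (2 a . ln y) g by similarities, and h contains |dz_(s+j0)|^2 as a flat
   factor; the Levi-Civita connection of h therefore descends to a closed Weyl
   structure with Lee form d (a . ln y) and reducible holonomy. It is not exact as
   a is nonzero on the lattice, and not flat because the plane (x_p, y_p) carries
   the curvature sum_(r <> p) a_r^2 + 1 - a_p > 0 at y = (1, .., 1).
   The embedding of O_K is treated through a primitive element: Vandermonde gives
   the independence of the embeddings (cocompactness), and the norm of a nonzero
   algebraic integer is at least 1 (discreteness). *)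

Require Import Defs.
From HB Require Import structures.
From mathcomp Require Import all_boot all_order all_algebra all_field.
From mathcomp Require Import generic_quotient complex.
From mathcomp Require Import all_classical all_reals all_analysis.
From mathcomp Require Import ring lra.

Set Implicit Arguments.
Unset Strict Implicit.
Unset Printing Implicit Defensive.

Import Order.TTheory GRing.Theory Num.Theory.
Import numFieldNormedType.Exports.

Local Open Scope classical_set_scope.
Local Open Scope ring_scope.
Local Open Scope complex_scope.
Local Open Scope quotient_scope.

(** * Embeddings of number fields *)

(** The charts are local inverses of the projection from H^s x C^t, so one formula in the
    coordinates of the cover defines a tensor in every chart, and its transformation rule becomes
    invariance under the affine maps z |-> u z + a. For this, each transition map must be a single
    group element near each point. Pointwise it is some element; a quantitative form of freeness and
    properness makes that element locally constant. The Jacobian is then locally constant too, which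
    removes the second-order term from the transformation rule of connections. A full lattice is
    given only by discreteness and a compact quotient, so the linear forms a_j are built without a
    Z-basis. Real and complex places are treated alike: if b_n denotes the form of ln |sigma_n|,
    then b_i = e_i at a real place and the metric is sum_n exp (- 2 b_n . ln y) |dz_n|^2. It is
    diagonal with monomial entries in y, so the connection is explicit and all verifications are
    algebraic. *)

Lemma intr_numfield_inj (K : fieldExtType rat) : injective (intr : int -> K).
Proof.
move=> m n /=; rewrite -!(@rmorph_int rat K (in_alg K)) => /fmorph_inj.
exact: intr_inj.
Qed.

Lemma intr_numfield_eq0 (K : fieldExtType rat) (m : int) :
  (m%:~R == 0 :> K) = (m == 0).
Proof. by rewrite -(inj_eq (@intr_numfield_inj K)) mulr0z. Qed.

(** Clearing denominators gives an integer polynomial [p] killing a primitive element [y];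
    multiplying [y] by the leading coefficient [b] keeps it a generator and makes it integral. *)
Lemma integral_generator (K : fieldExtType rat) :
  exists2 z : K, integer z & <<1; z>>%VS = fullv.
Proof.
pose y := separable_generator (1%AS : {subfield K}) {:K}.
have genK : <<1; y>>%VS = fullv.
  have /eq_adjoin_separable_generator/(_ (subvf _)) -> // :
    separable (1%AS : {subfield K}) {:K}.
  apply/separableP => x _; apply: pcharf0_separable => //.
  exact: ftrans (pchar_lalg K) (pchar_num _).
have /polyOver1P[q Dq] := minPolyOver (1%AS : {subfield K}) y.
have qy0 : root (map_poly (in_alg K) q) y by rewrite -Dq root_minPoly.
have nzq : q != 0 by rewrite -(map_poly_eq0 (in_alg K)) -Dq monic_neq0 ?monic_minPoly.
have [p [a nza Dp]] := rat_poly_scale q.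
pose pZ := map_poly (intr : int -> K) p.
have pZy0 : root pZ y.
  have -> : pZ = map_poly (in_alg K) (map_poly intr p).
    by rewrite -map_poly_comp; apply: eq_map_poly => b /=; rewrite scaler_int.
  have -> : map_poly intr p = a%:~R *: q.
    by rewrite Dp scalerA divff ?intr_eq0 // scale1r.
  by rewrite map_polyZ /= rootE hornerZ (rootP qy0) mulr0.
have nzp : p != 0 by apply: contraNneq nzq => p0; rewrite Dp p0 rmorph0 scaler0.
have sp : size pZ = size p by rewrite size_map_inj_poly //; exact: intr_numfield_inj.
pose n := (size p).-1; pose b := lead_coef p.
have nzb : b != 0 by rewrite lead_coef_eq0.
have n_gt0 : (0 < n)%N.
  rewrite /n; case E : (size p) => [|[|k]] //.
    by move/eqP: E; rewrite size_poly_eq0 (negPf nzp).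
  have /size_poly1P[c nzc Dc] : size p == 1%N by rewrite E.
  move: pZy0; rewrite /pZ Dc map_polyC rootC intr_numfield_eq0; by rewrite (negPf nzc).
exists (b%:~R * y); last first.
  have Dby : b%:~R * y = (b%:~R : rat) *: y by rewrite scaler_int mulrzl.
  apply/eqP; rewrite -genK eqEsubv Dby; apply/andP; split;
    apply/FadjoinP; rewrite ?subv_adjoin; split=> //.
    by rewrite memvZ // memv_adjoin.
  rewrite -[X in X \in _](@scalerK _ _ (b%:~R : rat)) ?intr_eq0 // memvZ //.
  exact: memv_adjoin.
(* [r] is b^(n-1) p(X / b): monic with integer coefficients, and its value at b y is b^(n-1)
   p(y). *)
pose r : {poly int} :=
  \poly_(i < n.+1) (if i == n then 1 else p`_i * b ^+ (n.-1 - i)).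
have szr : size r = n.+1 by apply: size_poly_eq; rewrite eqxx.
exists r; first by rewrite monicE lead_coefE szr coef_poly ltnSn eqxx.
apply/rootP; rewrite horner_coef size_map_inj_poly; [|exact: intr_numfield_inj|by []].
transitivity (b%:~R ^+ n.-1 * pZ.[y]); last by rewrite (rootP pZy0) mulr0.
have Sn : size p = n.+1 by rewrite /n prednK // lt0n size_poly_eq0.
rewrite horner_coef sp szr Sn mulr_sumr; apply: eq_bigr => [[i /= lti] _].
rewrite !coef_map_id0 ?mulr0z // coef_poly lti.
have [->|ne] := eqVneq i n.
  rewrite mul1r exprMn mulrA; congr (_ * _).
  have -> : p`_n = b by rewrite /b lead_coefE /n.
  by rewrite -{1}(prednK n_gt0) exprSr.
have lein : (i <= n.-1)%N by rewrite -ltnS prednK // ltn_neqAle ne -ltnS.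
rewrite rmorphM rmorphXn /= exprMn !mulrA; congr (_ * _).
by rewrite -mulrA -exprD subnK // mulrC.
Qed.
Section Embeddings.
Variables (R : realType) (K : fieldExtType rat).

Lemma fmorph_horner_alg (tau : {rmorphism K -> R[i]}) (q : {poly rat}) z :
  tau (map_poly (in_alg K) q).[z] = (map_poly ratr q).[tau z].
Proof.
rewrite -horner_map -map_poly_comp; congr _.[_]; apply: eq_map_poly => b /=.
exact: (fmorph_eq_rat (tau \o in_alg K)).
Qed.

Variables (z : K) (z_gen : <<1; z>>%VS = fullv).

Lemma numfield_polyP x : exists q, x = (map_poly (in_alg K) q).[z].
Proof. by apply/Fadjoin1_polyP; rewrite z_gen memvf. Qed.

Fact ratMinPoly_subproof :
  exists q : {poly rat}, map_poly (in_alg K) q = minPoly 1 z.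
Proof.
have /polyOver1P[q Dq] := minPolyOver (1%AS : {subfield K}) z.
by exists q.
Qed.

(** [minPoly 1 z] has its coefficients in [K]; a preimage over [rat] can also be mapped to
    [R[i]]. *)
Definition ratMinPoly : {poly rat} := projT1 (cid ratMinPoly_subproof).

Lemma ratMinPolyE : map_poly (in_alg K) ratMinPoly = minPoly 1 z.
Proof. by rewrite /ratMinPoly; case: cid. Qed.

Lemma ratMinPoly_dvdp q : root (map_poly (in_alg K) q) z -> ratMinPoly %| q.
Proof.
move=> qz; rewrite -(dvdp_map (in_alg K)) ratMinPolyE.
by apply: minPoly_dvdp => //; apply/polyOver1P; exists q.
Qed.

(** The value at [x] is obtained by writing [x] as a polynomial in [z] and evaluating at [r]; two
    such polynomials differ by a multiple of [ratMinPoly], which vanishes at [r]. *)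
Lemma embedding_of_root (r : R[i]) : root (map_poly ratr ratMinPoly) r ->
  exists tau : {rmorphism K -> R[i]}, tau z = r.
Proof.
move=> pr.
have [q qE] := choice numfield_polyP.
pose tau x := (map_poly ratr (q x)).[r].
have tauE p : tau (map_poly (in_alg K) p).[z] = (map_poly ratr p).[r].
  apply/eqP; rewrite -subr_eq0 /tau -hornerN -hornerD -!rmorphB /=.
  set d := _ - p; suff /dvdpP[e ->] : ratMinPoly %| d.
    by rewrite rmorphM hornerM (rootP pr) mulr0.
  apply: ratMinPoly_dvdp; apply/rootP.
  by rewrite rmorphB hornerD hornerN -qE subrr.
have tauB : zmod_morphism tau.
  by move=> x y; rewrite (qE x) (qE y) -hornerN -hornerD -rmorphB !tauE
    rmorphB hornerD hornerN.
have tauM : monoid_morphism tau.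
  split; last first.
    by move=> x y; rewrite (qE x) (qE y) -hornerM -rmorphM !tauE rmorphM hornerM.
  have -> : 1 = (map_poly (in_alg K) 1).[z] by rewrite rmorph1 hornerC.
  by rewrite tauE rmorph1 hornerC.
pose tA := GRing.isZmodMorphism.Build _ _ tau tauB.
pose tM := GRing.isMonoidMorphism.Build _ _ tau tauM.
pose t : {rmorphism K -> R[i]} := HB.pack tau tA tM.
exists t; have {1}-> : z = (map_poly (in_alg K) 'X).[z].
  by rewrite map_polyX hornerX.
by rewrite [LHS]tauE map_polyX hornerX.
Qed.

Variables (N : nat) (sg : 'I_N -> {rmorphism K -> R[i]}).
Hypothesis sg_all : forall tau : {rmorphism K -> R[i]}, exists! i, sg i =1 tau.

Lemma embedding_genI : injective (fun i => sg i z).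
Proof.
move=> i j eq_ij; have [k [_ uniqk]] := sg_all (sg i).
rewrite -(uniqk i) // -(uniqk j) // => x.
by have [q ->] := numfield_polyP x; rewrite !fmorph_horner_alg eq_ij.
Qed.

(** By separability the complex roots are distinct, and evaluation at [z] matches the embeddings
    with these roots. *)
Lemma size_ratMinPoly : size ratMinPoly = N.+1.
Proof.
pose p : {poly R[i]} := map_poly ratr ratMinPoly.
have [r Dp] := closed_field_poly_normal p.
have monp : p \is monic.
  by rewrite map_monic -(map_monic (in_alg K)) ratMinPolyE monic_minPoly.
rewrite (monicP monp) scale1r in Dp.
have ur : uniq r.
  rewrite -separable_prod_XsubC -Dp separable_map -(separable_map (in_alg K)).
  rewrite ratMinPolyE; apply: pcharf0_separable.
  exact: ftrans (pchar_lalg K) (pchar_num _).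
pose e := [seq sg i z | i <- enum 'I_N].
have ue : uniq e by rewrite map_inj_uniq ?enum_uniq //; exact: embedding_genI.
have /(uniq_perm ur ue)/perm_size : r =i e.
  move=> x; apply/idP/mapP=> [xr|[i _ ->]].
    have /embedding_of_root[tau <-] : root p x by rewrite Dp root_prod_XsubC.
    have [i [sgi _]] := sg_all tau; exists i; rewrite ?mem_enum //.
  rewrite -root_prod_XsubC -Dp /p /root -fmorph_horner_alg ratMinPolyE.
  by rewrite minPolyxx rmorph0.
rewrite size_map size_enum_ord => sr.
by rewrite -(size_map_poly (@ratr R[i])) -/p Dp size_prod_XsubC sr.
Qed.

Definition embedding_mx : 'M[R[i]]_N := Vandermonde N (\row_i sg i z).

Lemma embedding_mx_unit : embedding_mx \in unitmx.
Proof.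
rewrite unitmxE det_Vandermonde unitfE; apply/prodf_neq0 => i _.
apply/prodf_neq0 => j ltij; rewrite !mxE subr_eq0 (inj_eq embedding_genI).
by rewrite neq_ltn ltij orbT.
Qed.

(** The product is the norm: multiplication by [a] has a rational matrix on the powers of [z], and
    the Vandermonde matrix diagonalizes it with the conjugates of [a] as eigenvalues. *)
Lemma prod_embeddings_rat a : exists q : rat, \prod_i sg i a = ratr q.
Proof.
have /choice[M ME] (k : 'I_N) : exists q : {poly rat},
    (size q <= N)%N /\ a * z ^+ k = (map_poly (in_alg K) q).[z].
  have [q qE] := numfield_polyP (a * z ^+ k); exists (q %% ratMinPoly); split.
    rewrite -ltnS -size_ratMinPoly ltn_modp -(map_poly_eq0 (in_alg K)).
    by rewrite ratMinPolyE monic_neq0 ?monic_minPoly.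
  rewrite qE {1}(divp_eq q ratMinPoly) rmorphD rmorphM hornerD hornerM /=.
  by rewrite ratMinPolyE minPolyxx mulr0 add0r.
pose Mx : 'M[rat]_N := \matrix_(k, l) (M k)`_l.
exists (\det Mx); rewrite -det_map_mx; set M' := map_mx _ _.
have VM : embedding_mx *m diag_mx (\row_i sg i a) = M' *m embedding_mx.
  apply/matrixP => k i; rewrite mul_mx_diag !mxE mulrC -rmorphXn -rmorphM.
  have [sM ->] := ME k; rewrite fmorph_horner_alg.
  rewrite (@horner_coef_wide _ N) ?size_map_poly //.
  by apply: eq_bigr => l _; rewrite coef_map !mxE.
have /(congr1 determinant) := VM; rewrite !det_mulmx det_diag.
rewrite mulrC => /mulIf; under eq_bigr do rewrite mxE; apply.
by rewrite -unitfE -unitmxE embedding_mx_unit.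
Qed.

End Embeddings.

(** * The absolute value of complex numbers, with real values *)

Section ComplexAbs.
Variable R : realType.
Implicit Types x y z : R[i].

(** In [R[i]] the norm is again a complex number; its real part gives access to the order and the
    logarithm of [R]. *)
Definition cabs z : R := complex.Re `|z|.

Lemma cabsE z : cabs z = Num.sqrt (complex.Re z ^+ 2 + complex.Im z ^+ 2).
Proof. by rewrite /cabs normc_def. Qed.

Lemma cabs_ge0 z : 0 <= cabs z.
Proof. by rewrite cabsE sqrtr_ge0. Qed.

Lemma sqr_cabs z : cabs z ^+ 2 = complex.Re z ^+ 2 + complex.Im z ^+ 2.
Proof. by rewrite cabsE sqr_sqrtr // addr_ge0 ?sqr_ge0. Qed.

Lemma cabsM x y : cabs (x * y) = cabs x * cabs y.
Proof. exact: Normc.normcM. Qed.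

Lemma cabs1 : cabs 1 = 1.
Proof. by rewrite /cabs normr1. Qed.

Lemma cabs_prod (I : Type) (r : seq I) (P : pred I) (F : I -> R[i]) :
  cabs (\prod_(i <- r | P i) F i) = \prod_(i <- r | P i) cabs (F i).
Proof. exact: (big_morph cabs cabsM cabs1). Qed.

Lemma cabsN z : cabs (- z) = cabs z.
Proof. by rewrite /cabs normrN. Qed.

Lemma cabsV z : cabs z^-1 = (cabs z)^-1.
Proof. exact: Normc.normcV. Qed.

Lemma ler_cabsD x y : cabs (x + y) <= cabs x + cabs y.
Proof. exact: le_normcD. Qed.

Lemma ler_cabs_sum (I : Type) (r : seq I) (P : pred I) (F : I -> R[i]) :
  cabs (\sum_(i <- r | P i) F i) <= \sum_(i <- r | P i) cabs (F i).
Proof.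
elim/big_ind2: _ => // [|x a y b xa yb]; first by rewrite /cabs normr0.
exact: le_trans (ler_cabsD _ _) (lerD xa yb).
Qed.

Lemma cabs_gt0 z : (0 < cabs z) = (z != 0).
Proof.
rewrite lt_def cabs_ge0 andbT; congr negb; apply/eqP/eqP => [|->].
  exact: Normc.eq0_normc.
by rewrite /cabs normr0.
Qed.

Lemma cabs_real (r : R) : cabs r%:C = `|r|.
Proof. by rewrite cabsE /= expr0n addr0 sqrtr_sqr. Qed.

Lemma cabs_conj z : cabs z^* = cabs z.
Proof. by rewrite !cabsE; case: z => a b /=; rewrite sqrrN. Qed.

Lemma ler_Re_cabs z : `|complex.Re z| <= cabs z.
Proof. by rewrite cabsE -sqrtr_sqr ler_wsqrtr // lerDl sqr_ge0. Qed.

Lemma ler_Im_cabs z : `|complex.Im z| <= cabs z.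
Proof. by rewrite cabsE -sqrtr_sqr ler_wsqrtr // lerDr sqr_ge0. Qed.

Lemma ler_cabs_ReIm z : cabs z <= `|complex.Re z| + `|complex.Im z|.
Proof.
rewrite -(@ler_pXn2r _ 2) ?nnegrE ?cabs_ge0 ?addr_ge0 // sqr_cabs.
rewrite -(real_normK (num_real (complex.Re z))).
rewrite -(real_normK (num_real (complex.Im z))) sqrrD.
by rewrite addrAC lerDl mulrn_wge0 // mulr_ge0.
Qed.

Lemma conjc_eq_real z : z^* = z -> z = (complex.Re z)%:C.
Proof.
case: z => a b [/eqP]; rewrite eq_sym -addr_eq0 -mulr2n mulrn_eq0 /=.
by move/eqP => ->.
Qed.

End ComplexAbs.

(** The number is carried to [algC], where a rational algebraic integer is known to be an
    integer. *)
Lemma integer_rat (q : rat) : integralOver (intr : int -> rat) q ->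
  exists m : int, q = m%:~R.
Proof.
move=> [p monp pq0].
have rq : root (map_poly (intr : int -> algC) p) (ratr q).
  have -> : map_poly (intr : int -> algC) p = map_poly ratr (map_poly intr p).
    by rewrite -map_poly_comp; apply: eq_map_poly => b /=; rewrite rmorph_int.
  by rewrite fmorph_root.
have : (ratr q : algC) \in Num.int.
  apply: Cint_rat_Aint; first exact: Crat_rat.
  apply: root_monic_Aint rq _ _.
    by rewrite monicE lead_coef_map_inj ?(monicP monp) //; exact: intr_inj.
  by apply/polyOverP => i; rewrite coef_map_id0 ?mulr0z // intr_int.
case/intrP => m Dm; exists m; apply: (fmorph_inj (@ratr algC)).
exact: etrans Dm (esym (rmorph_int _ _)).
Qed.

Lemma integral_ratr (F : numFieldType) (q : rat) :
  integralOver (intr : int -> F) (ratr q) -> integralOver (intr : int -> rat) q.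
Proof.
move=> [p monp pq0]; exists p => //; rewrite -(fmorph_root (@ratr F)).
by rewrite -map_poly_comp (eq_map_poly (g := intr)) // => b /=; rewrite rmorph_int.
Qed.

(** * Norms of algebraic integers, and approximation by them *)

Section IntegerEmbeddings.
Variables (R : realType) (K : fieldExtType rat).
Variables (N : nat) (sg : 'I_N -> {rmorphism K -> R[i]}).
Hypothesis sg_all : forall tau : {rmorphism K -> R[i]}, exists! i, sg i =1 tau.

Lemma integral_prod_embeddings (a : K) : integer a ->
  integralOver (intr : int -> R[i]) (\prod_i sg i a).
Proof.
move=> inta; elim/big_ind: _ => [|x y|i _].
- exact: (integral1 (intr : {rmorphism int -> R[i]})).
- exact: (@integral_mul _ _ (intr : {rmorphism int -> R[i]})).
- have [p monp pa] := integral_rmorph (sg i) inta; exists p => //.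
  by rewrite (eq_map_poly (g := sg i \o intr)) // => b /=; rewrite rmorph_int.
Qed.

Lemma prod_embeddings_int (a : K) : integer a ->
  exists m : int, \prod_i sg i a = m%:~R.
Proof.
have [z _ z_gen] := integral_generator K => inta.
have [q Dq] := prod_embeddings_rat z_gen sg_all a.
have := integral_prod_embeddings inta; rewrite Dq => /integral_ratr.
by move=> /integer_rat[m ->]; exists m; rewrite rmorph_int.
Qed.

(** The product of the conjugates is a nonzero rational integer. The discreteness of the ring of
    integers rests on this bound. *)
Lemma prod_cabs_ge1 (a : K) : integer a -> a != 0 -> 1 <= \prod_i cabs (sg i a).
Proof.
move=> inta a0; have [m Dm] := prod_embeddings_int inta.
rewrite -cabs_prod Dm -(rmorph_int (real_complex R)) cabs_real.
rewrite -intr_norm ler1z -gtz0_ge1 normr_gt0 -(intr_eq0 R[i]) -Dm.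
by apply/prodf_neq0 => i _; rewrite fmorph_eq0.
Qed.

(** The lower bound 1 holds for [a] and for its inverse, and the two products multiply to 1. *)
Lemma prod_cabs_unit (a : K) : integer a -> integer a^-1 -> a != 0 ->
  \prod_i cabs (sg i a) = 1.
Proof.
move=> inta intV a0; have a_ge1 := prod_cabs_ge1 inta a0.
have aV_ge1 := prod_cabs_ge1 intV (invr_neq0 a0).
apply/eqP; rewrite eq_le a_ge1 andbT -[leLHS]mulr1.
apply: le_trans (ler_wpM2l _ aV_ge1) _; first exact: le_trans a_ge1.
rewrite -big_split big1 //= => i _.
by rewrite -cabsM -rmorphM divff // rmorph1 cabs1.
Qed.

Lemma integer_sum (I : Type) (r : seq I) (P : pred I) (F : I -> K) :
  (forall i, P i -> integer (F i)) -> integer (\sum_(i <- r | P i) F i).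
Proof.
move=> intF; elim/big_ind: _ => // [|x y].
  exact: (mxpoly.integral0 (intr : {rmorphism int -> K})).
exact: (@integral_add _ _ (intr : {rmorphism int -> K})).
Qed.

Lemma integerM (x y : K) : integer x -> integer y -> integer (x * y).
Proof. exact: (@integral_mul _ _ (intr : {rmorphism int -> K})). Qed.

Lemma integerB (x y : K) : integer x -> integer y -> integer (x - y).
Proof. exact: (@integral_sub _ _ (intr : {rmorphism int -> K})). Qed.

Lemma integerX (x : K) n : integer x -> integer (x ^+ n).
Proof.
move=> intx; elim: n => [|n IHn]; last by rewrite exprS; apply: integerM.
exact: (integral1 (intr : {rmorphism int -> K})).
Qed.

Lemma integer_int (m : int) : integer (m%:~R : K).
Proof. exact: (integral_id (intr : {rmorphism int -> K}) m). Qed.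

(** Integer combinations of the powers of [z] already suffice: solve for the coefficients with the
    Vandermonde matrix and take integer parts. Symmetry under [bar] makes the coefficients real. *)
Lemma integer_approx (bar : 'I_N -> 'I_N) : involutive bar ->
    (forall i a, sg (bar i) a = (sg i a)^*) ->
  exists B : R, forall x : 'I_N -> R[i], (forall i, x (bar i) = (x i)^*) ->
    exists2 a, integer a & forall i, cabs (sg i a - x i) <= B.
Proof.
move=> barK sg_bar; have [z intz z_gen] := integral_generator K.
(* Fractional parts are at most 1, so the inner sum bounds the error at place [i]; adding over [i]
   makes the bound uniform. *)
pose B := \sum_i \sum_(k < N) cabs (sg i z ^+ k).
exists B => x x_bar; pose V := embedding_mx z sg.
have uV : V \in unitmx by exact: embedding_mx_unit.
pose c := (\row_i x i) *m invmx V.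
have cV : c *m V = \row_i x i by rewrite mulmxKV.
(* Conjugating the system permutes its columns by [bar], so the conjugate of [c] solves the same
   system. *)
have c_real : map_mx conjc c = c.
  suff : map_mx conjc c *m V = c *m V.
    by move/(congr1 (mulmx^~ (invmx V))); rewrite !mulmxK.
  rewrite cV; apply/rowP => i; rewrite -(barK i) !mxE x_bar.
  have /rowP/(_ (bar i)) := cV; rewrite !mxE => <-.
  rewrite rmorph_sum; apply: eq_bigr => k _.
  by rewrite rmorphM !mxE /= sg_bar rmorphXn.
pose f k := Num.floor (complex.Re (c 0 k)).
exists (\sum_k (f k)%:~R * z ^+ k).
  by apply: integer_sum => k _; apply: integerM (integer_int _) (integerX _ _).
move=> i; have /rowP/(_ i) := cV; rewrite [in RHS]mxE => <-; rewrite mxE.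
rewrite rmorph_sum -sumrB; apply: le_trans (ler_cabs_sum _ _ _) _.
apply: (@le_trans _ _ (\sum_(k < N) cabs (sg i z ^+ k))); last first.
  rewrite /B [leRHS](bigD1 i) //= lerDl sumr_ge0 // => j _.
  by rewrite sumr_ge0 // => k _; apply: cabs_ge0.
apply: ler_sum => k _; have -> : V k i = sg i z ^+ k by rewrite !mxE.
rewrite rmorphM rmorph_int rmorphXn -mulrBl cabsM.
rewrite ler_piMl ?cabs_ge0 //.
have -> : c 0 k = (complex.Re (c 0 k))%:C.
  by apply: conjc_eq_real; move/rowP/(_ k): c_real; rewrite mxE.
rewrite -(rmorph_int (real_complex R)) -rmorphB cabs_real distrC.
have := floor_itv (complex.Re (c 0 k)).
rewrite intrD1 -/(f k) => /andP[lef ltf].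
by rewrite ger0_norm ?subr_ge0 // lerBlDl; exact: ltW.
Qed.

End IntegerEmbeddings.

(** * Integers and positive units at the first s + t embeddings *)

Section OTArithmetic.
Variables (R : realType) (K : fieldExtType rat) (s t : nat).
Variable sigma : 'I_(s + t + t) -> {rmorphism K -> R[i]}.
Hypothesis Hsigma : lists_embeddings sigma.

Local Notation sg m := (sigma (lshift t m)).

Lemma sigma_real (i : 'I_s) a :
  sg (lshift t i) a = (complex.Re (sg (lshift t i) a))%:C.
Proof.
have [_ /(_ i a) Im0 _ _] := Hsigma; move: Im0.
by case: (sg _ a) => x y /= ->.
Qed.

Lemma sigma_conj (j : 'I_t) a :
  sigma (rshift (s + t) j) a = (sg (rshift s j) a)^*.
Proof. by have [_ _ _ ->] := Hsigma. Qed.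

Definition conj_index (i : 'I_(s + t + t)) : 'I_(s + t + t) :=
  match fintype.split i with
  | inl m => match fintype.split m with
             | inl i' => lshift t (lshift t i')
             | inr j => rshift (s + t) j
             end
  | inr j => lshift t (rshift s j)
  end.

Lemma conj_index_lr j : conj_index (lshift t (rshift s j)) = rshift (s + t) j.
Proof. by rewrite /conj_index (unsplitK (inl _)) (unsplitK (inr _)). Qed.

Lemma conj_index_ll i :
  conj_index (lshift t (lshift t i)) = lshift t (lshift t i).
Proof. by rewrite /conj_index (unsplitK (inl _)) (unsplitK (inl _)). Qed.

Lemma conj_index_r j : conj_index (rshift (s + t) j) = lshift t (rshift s j).
Proof. by rewrite /conj_index (unsplitK (inr _)). Qed.

Definition conj_indexE := (conj_index_ll, conj_index_lr, conj_index_r).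

Lemma index_ind (P : 'I_(s + t + t) -> Prop) :
    (forall i, P (lshift t (lshift t i))) ->
    (forall j, P (lshift t (rshift s j))) ->
    (forall j, P (rshift (s + t) j)) -> forall i, P i.
Proof.
move=> Pll Plr Pr i; rewrite -(splitK i); case: (fintype.split i) => [m|j] //=.
by rewrite -(splitK m); case: (fintype.split m) => j /=.
Qed.

Lemma conj_indexK : involutive conj_index.
Proof. by elim/index_ind => j; rewrite !conj_indexE. Qed.

Lemma sigma_conj_index i a : sigma (conj_index i) a = (sigma i a)^*.
Proof.
elim/index_ind: i => j; rewrite !conj_indexE ?sigma_conj ?conjcK //.
by rewrite sigma_real conjc_real.
Qed.

Lemma prod_cabs_sigma a : \prod_i cabs (sigma i a) =
  (\prod_(m < s + t) cabs (sg m a)) * \prod_(j < t) cabs (sg (rshift s j) a).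
Proof.
rewrite big_split_ord; congr (_ * _); apply: eq_bigr => j _.
by rewrite sigma_conj cabs_conj.
Qed.

Hypothesis s_gt0 : (0 < s)%N.

(** The last [t] embeddings repeat absolute values of earlier ones, so a nonzero [a] would have a
    norm of absolute value below 1. *)
Lemma sigma_discrete a : integer a -> (forall m, cabs (sg m a) < 1) -> a = 0.
Proof.
have [sg_all _ _ _] := Hsigma => inta a_lt1; apply/eqP/negPn/negP => a0.
have := prod_cabs_ge1 sg_all inta a0; rewrite prod_cabs_sigma.
apply/negP; rewrite -ltNge.
have le01 m : 0 <= cabs (sg m a) <= 1 by rewrite cabs_ge0 ltW.
have prod1 (I : finType) (P : pred I) (F : I -> 'I_(s + t)) :
    0 <= \prod_(i | P i) cabs (sg (F i) a) <= 1.
  rewrite prodr_ge0 => [|i _]; last by case/andP: (le01 (F i)).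
  exact: prodr_ile1.
(* All factors are at most 1; isolating one that is below 1 makes the inequality strict. *)
pose m0 := lshift t (Ordinal s_gt0).
have /andP[? ?] := prod1 _ xpredT (@rshift s t).
have /andP[? ?] := prod1 _ (fun m => m != m0) id.
rewrite (bigD1 m0) //= -mulrA.
apply: (@le_lt_trans _ _ (cabs (sg m0 a))) => //.
apply: ler_piMr; first exact: cabs_ge0.
exact: mulr_ile1.
Qed.

(** Prescribing conjugate values at the last [t] embeddings yields a symmetric target for
    [integer_approx]; at a real place symmetry means that the target is real. *)
Lemma sigma_approx : exists B : R, forall x : 'I_(s + t) -> R[i],
  (forall i : 'I_s, complex.Im (x (lshift t i)) = 0) ->
  exists2 a, integer a & forall m, cabs (sg m a - x m) <= B.
Proof.
have [sg_all _ _ _] := Hsigma.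
have [B HB] := integer_approx sg_all conj_indexK sigma_conj_index.
exists B => x x_real.
pose y i := match fintype.split i with inl m => x m | inr j => (x (rshift s j))^* end.
have yl m : y (lshift t m) = x m by rewrite /y (unsplitK (inl _)).
have yr j : y (rshift (s + t) j) = (x (rshift s j))^*.
  by rewrite /y (unsplitK (inr _)).
have [|a inta aB] := HB y; last by exists a => // m; rewrite -yl.
elim/index_ind => j; rewrite !conj_indexE ?yl ?yr ?conjcK //.
by have := x_real j; case: (x _) => u v /= ->; rewrite oppr0.
Qed.

Lemma ellE u m : ell sigma u 0 m =
  if fintype.split m is inl _ then ln (cabs (sg m u)) else 2 * ln (cabs (sg m u)).
Proof.
rewrite -(splitK m); case: (fintype.split m) => j; rewrite unsplitK /=.
  by rewrite row_mxEl mxE.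
by rewrite row_mxEr mxE.
Qed.

Lemma sum_ln_cabs_unit u : positive_unit sigma u ->
  \sum_(i < s) ln (cabs (sg (lshift t i) u))
   + 2 * \sum_(j < t) ln (cabs (sg (rshift s j) u)) = 0.
Proof.
move=> [u0 intu intV _]; have [sg_all _ _ _] := Hsigma.
have := prod_cabs_unit sg_all intu intV u0; rewrite prod_cabs_sigma.
have cgt0 m : 0 < cabs (sg m u) by rewrite cabs_gt0 fmorph_eq0.
have ln_prod (I : finType) (F : I -> R) : (forall i, 0 < F i) ->
    ln (\prod_i F i) = \sum_i ln (F i).
  move=> F0; apply: expR_inj.
  rewrite lnK ?posrE ?prodr_gt0 // expR_sum.
  by apply: eq_bigr => i _; rewrite lnK // posrE.
move/(congr1 (@ln R)); rewrite ln1 lnM ?posrE ?prodr_gt0 // !ln_prod //.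
by rewrite big_split_ord /= -addrA -mulr2n mulr_natl.
Qed.

Lemma positive_unit_cabs u (i : 'I_s) : positive_unit sigma u ->
  sg (lshift t i) u = (cabs (sg (lshift t i) u))%:C.
Proof.
move=> [_ _ _ /(_ i)]; rewrite sigma_real => u_gt0.
rewrite cabs_real ger0_norm //; apply: ltW.
by move: u_gt0; rewrite ltcE => /andP[].
Qed.

(** At a real place a positive unit equals its absolute value, and one embedding is already
    injective. *)
Lemma positive_unit_eq u v : positive_unit sigma u -> positive_unit sigma v ->
    (forall i : 'I_s, cabs (sg (lshift t i) u) = cabs (sg (lshift t i) v)) ->
  u = v.
Proof.
move=> pu pv uv; apply: (fmorph_inj (sg (lshift t (Ordinal s_gt0)))).
by rewrite (positive_unit_cabs _ pu) (positive_unit_cabs _ pv) uv.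
Qed.

End OTArithmetic.
(** * Lattices *)

Section OrbitSpaceTopology.
Variables (T : topologicalType) (orb : T -> set T).

Lemma orbit_projP x y : orbit_proj orb x = orbit_proj orb y <-> orb x = orb y.
Proof.
split=> [/eqquotP/asboolP //|xy].
by apply/eqquotP/asboolP.
Qed.

Lemma orbit_proj_surj (q : orbit_space orb) : exists x, orbit_proj orb x = q.
Proof. by exists (repr q); rewrite /orbit_proj reprK. Qed.

(** Orbits are given as sets, without a group; the orbit-preserving local map [phi] stands for the
    group element that takes [y] to [x]. *)
Lemma orbit_proj_open (A : set T) :
    (forall x y, orb x = orb y -> exists phi : T -> T,
       [/\ phi y = x, {for y, continuous phi}
         & \forall z \near y, orb (phi z) = orb z]) ->
  open A -> open (orbit_proj orb @` A).
Proof.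
move=> orbV openA.
suff : open (orbit_proj orb @^-1` (orbit_proj orb @` A)) by [].
rewrite openE => y /= -[x Ax /orbit_projP xy].
have [phi [phiy cphi orbphi]] := orbV _ _ xy.
have nA : \forall z \near y, A (phi z).
  by apply: cphi; rewrite phiy; exact: open_nbhs_nbhs.
by near=> z; exists (phi z); [near: z | apply/orbit_projP; near: z].
Unshelve. all: by end_near. Qed.

End OrbitSpaceTopology.
Section MatrixNorm.
Variables (R : realType) (m n : nat).
Implicit Types x : 'M[R]_(m, n).

Lemma normr_mx_le x B : 0 <= B -> `|x| <= B <-> forall i j, `|x i j| <= B.
Proof.
move=> B0; rewrite [`|x|]/Num.Def.normr /= mx_normrE; split=> [xB i j|xB].
  by apply: le_trans xB; exact: (le_bigmax _ (fun ij => `|x ij.1 ij.2|) (i, j)).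
by apply/bigmax_le => // -[i j] _; exact: xB.
Qed.

Lemma coord_le_norm x i j : `|x i j| <= `|x|.
Proof. by have /(_ _)/iffLR/(_ (lexx _)) := @normr_mx_le x `|x|; exact. Qed.

Lemma normr_mx_lt x B : 0 < B -> `|x| < B <-> forall i j, `|x i j| < B.
Proof.
move=> B0; split=> [xB i j|xB]; first exact: le_lt_trans (coord_le_norm _ _ _) xB.
rewrite [`|x|]/Num.Def.normr /= mx_normrE.
by apply/bigmax_lt => // -[i j] _; exact: xB.
Qed.

End MatrixNorm.

Section FullLattice.
Variables (R : realType) (s : nat) (L : set 'rV[R]_s).
Hypothesis HL : full_lattice L.

Let L0 : L 0. Proof. by case: HL. Qed.
Let LB x y : L x -> L y -> L (x - y). Proof. by case: HL => _ + _ _; apply. Qed.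
Let LN x : L x -> L (- x). Proof. by rewrite -sub0r; exact: LB. Qed.
Let LD x y : L x -> L y -> L (x + y).
Proof. by move=> Lx Ly; rewrite -[y]opprK; apply: LB => //; exact: LN. Qed.

Lemma lattice_sum (I : Type) (r : seq I) (F : I -> 'rV[R]_s) :
  (forall i, L (F i)) -> L (\sum_(i <- r) F i).
Proof. by move=> LF; elim/big_ind: _ => //; exact: LD. Qed.

Lemma lattice_int (m : int) x : L x -> L (m%:~R *: x).
Proof.
move=> Lx; rewrite scaler_int.
have Lnat n : L (x *+ n).
  by elim: n => [|n IHn]; rewrite ?mulr0n // mulrSr; apply: LD.
by case: m => n; rewrite ?NegzE ?mulrNz; [exact: Lnat | apply/LN/Lnat].
Qed.

Lemma lattice_discrete : exists2 e : R, 0 < e & forall l, L l -> `|l| < e -> l = 0.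
Proof.
case: HL => _ _ /(_ 0 L0)[_ [V /nbhs_ballP[e e0 eV] VL]] _.
exists e => // l Ll le; suff : (V `&` L) l by rewrite VL.
by split=> //; apply: eV; rewrite -ball_normE /= sub0r normrN.
Qed.

(** The images of unit balls form an open cover of the compact quotient, so one large ball contains
    a representative of every class. *)
Lemma lattice_cobounded : exists B : R,
  forall x : 'rV[R]_s, exists2 l, L l & `|x - l| <= B.
Proof.
case: HL => _ _ _; set orb := fun x : 'rV[R]_s => _.
move=> /compact_near_coveringP cptQ.
have orbD x l : L l -> orb (x + l) = orb x.
  move=> Ll; apply/seteqP; split=> _ [k Lk <-].
    by exists (l + k); [exact: LD | rewrite addrA].
  by exists (k - l); [exact: LB | rewrite addrACA subrr addr0].
have orbP x y : orb x = orb y -> exists2 l, L l & x = y + l.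
  move=> xy; have : orb x x by exists 0; rewrite ?addr0.
  by rewrite xy => -[l Ll <-]; exists l.
have proj_open (A : set 'rV[R]_s) : open A -> open (orbit_proj orb @` A).
  move=> oA; apply: orbit_proj_open oA => x y /orbP[l Ll ->].
  exists (fun z => z + l); split=> //.
    by apply: continuousD; [exact: cvg_id | exact: cst_continuous].
  by near=> z; exact: orbD.
have := cptQ nat \oo (fun N q => exists2 x, orbit_proj orb x = q & `|x| <= N%:R) _.
case=> [q _|N _ /(_ N (leqnn N)) cover].
  have [x <-] := orbit_proj_surj q.
  exists (orbit_proj orb @` ball x 1, [set n | (`|x| + 1 <= n%:R)]).
    split=> /=; last exact: nbhs_infty_ger.
    apply: open_nbhs_nbhs; split; first by apply: proj_open; exact: ball_open.
    by exists x => //; exact: ballxx.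
  move=> [_ n] [/= [y xy <-] xn]; exists y => //.
  apply: le_trans xn; rewrite -[y](subrK x) addrC (le_trans (ler_normD _ _)) //.
  rewrite lerD2l; move: xy; rewrite -ball_normE /= distrC; exact: ltW.
exists N%:R => x; have [y + yN] := cover (orbit_proj orb x) I.
move=> /orbit_projP/esym/orbP[l Ll ->]; exists l => //.
by rewrite addrK.
Unshelve. all: by end_near. Qed.

(** Lattice vectors within [B] of the vectors N e_i form a diagonally dominant matrix once [N]
    exceeds s B. They are a basis of the vector space; that they generate [L] is not claimed. *)
Lemma lattice_basis : exists2 M : 'M[R]_s, M \in unitmx & forall i, L (row i M).
Proof.
have [B HB] := lattice_cobounded.
have B0 : 0 <= B by have [l _] := HB 0; exact: le_trans.
have [N ltN] : exists N : nat, s%:R * B < N%:R.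
  exists (Num.trunc (s%:R * B)).+1.
  by rewrite truncnS_gt // mulr_ge0.
have /choice[f fP] (i : 'I_s) : exists l,
    L l /\ `|N%:R *: delta_mx 0 i - l| <= B.
  by have [l Ll lB] := HB (N%:R *: delta_mx 0 i); exists l.
pose M : 'M[R]_s := \matrix_i f i.
exists M => [|i]; last by rewrite rowK; have [] := fP i.
pose E := N%:R%:M - M.
have EB i j : `|E i j| <= B.
  have [_ /(normr_mx_le _ B0)/(_ 0 j)] := fP i.
  by rewrite !mxE eqxx mulr_natr eq_sym.
rewrite -unitmx_tr -row_free_unit; apply: inj_row_free => v vM.
have Nv : N%:R *: v = v *m E^T.
  by rewrite linearB /= tr_scalar_mx mulmxBr vM subr0 mul_mx_scalar.
have vB : N%:R * `|v| <= s%:R * B * `|v|.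
  rewrite -[X in X * `|v|]ger0_norm // -normrZ Nv.
  apply/normr_mx_le; first by rewrite !mulr_ge0.
  move=> i j; rewrite mxE; apply: le_trans (ler_norm_sum _ _ _) _.
  apply: le_trans (ler_sum _ (_ : forall k, xpredT k -> _ <= B * `|v|)) _.
    move=> k _; rewrite mxE normrM mulrC.
    by apply: ler_pM => //; exact: coord_le_norm.
  by rewrite sumr_const card_ord -[leLHS]mulr_natl mulrA.
apply/eqP; rewrite -normr_eq0 eq_le normr_ge0 andbT leNgt.
apply/negP => v_gt0; move: vB; rewrite ler_pM2r // leNgt ltN //.
Qed.

Lemma lattice_span (a : 'cV[R]_s) : (forall l, L l -> l *m a = 0) -> a = 0.
Proof.
have [M uM LM] := lattice_basis => La.
rewrite -[a](mulKmx uM) [M *m a](_ : _ = 0) ?mulmx0 //.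
by apply/row_matrixP => i; rewrite row_mul row0; exact: La.
Qed.

(* Subtract the linear form agreeing with [f] on a basis contained in [L]: what
   remains is additive and bounded, hence zero. *)
Lemma lattice_linear_ext (f : 'rV[R]_s -> R) :
    (forall x y, L x -> L y -> f (x - y) = f x - f y) ->
  exists a : 'cV[R]_s, forall l, L l -> f l = (l *m a) 0 0.
Proof.
have [M uM LM] := lattice_basis => fB.
pose a : 'cV[R]_s := invmx M *m (\col_i f (row i M)).
exists a; pose g l := f l - (l *m a) 0 0.
have gB x y : L x -> L y -> g (x - y) = g x - g y.
  by move=> Lx Ly; rewrite /g fB // mulmxBl !mxE; ring.
have g0 : g 0 = 0 by have := gB 0 0 L0 L0; rewrite !subrr.
have gN x : L x -> g (- x) = - g x by move=> Lx; rewrite -sub0r gB // g0 sub0r.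
have gD x y : L x -> L y -> g (x + y) = g x + g y.
  by move=> Lx Ly; rewrite -[y]opprK gB ?gN //; exact: LN.
have gnat n x : L x -> g (x *+ n) = g x *+ n.
  move=> Lx; elim: n => [|n IHn]; first by rewrite !mulr0n.
  by rewrite !mulrSr gD ?IHn // -scaler_nat; exact: (lattice_int n).
have gint (m : int) x : L x -> g (m%:~R *: x) = m%:~R * g x.
  move=> Lx; rewrite scaler_int; case: m => n; first by rewrite -pmulrn gnat // mulr_natl.
  rewrite NegzE mulrNz gN; last by rewrite -scaler_int; exact: lattice_int.
  by rewrite -pmulrn gnat // mulrNz mulNr mulr_natl.
have gsum (F : 'I_s -> 'rV[R]_s) : (forall i, L (F i)) ->
    g (\sum_i F i) = \sum_i g (F i).
  move=> LF; elim: (index_enum _) => [|i r IHr]; first by rewrite !big_nil.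
  by rewrite !big_cons gD ?IHr //; exact: lattice_sum.
have gM i : g (row i M) = 0.
  rewrite /g -row_mul mulKVmx // !mxE; exact: subrr.
have [e e0 He] := lattice_discrete.
pose C := \sum_i `|row i M|.
have C0 : 0 <= C by apply: sumr_ge0.
have cptC : compact [set x : 'rV[R]_s | `|x| <= C].
  apply: bounded_closed_compact.
    by exists C; split=> [|r Cr x /= xC]; [exact: num_real | apply: le_trans xC (ltW _)].
  rewrite (_ : [set x | _] = closed_ball_ (@Num.norm R _) (0 : 'rV[R]_s) C).
    exact: closed_closed_ball_.
  by apply/seteqP; split=> x /=; rewrite /closed_ball_ /= sub0r normrN.
have [] := (compact_near_coveringP _).1 cptC nat \oo
  (fun N x => L x -> `|g x| <= N%:R) _.
  move=> x _.
  (* A ball of radius [e / 2] contains at most one lattice point, so [g] is locally bounded on [L],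
     hence bounded on the part of [L] in a compact ball. *)
  have [[l [Ll xl]]|nol] := pselect (exists l, L l /\ `|x - l| < e / 2).
    exists (ball x (e / 2), [set n | `|g l| <= n%:R]).
      split=> /=; [by apply: nbhsx_ballx; rewrite divr_gt0 | exact: nbhs_infty_ger].
    move=> [y n] /= [xy gl] Ly; suff -> : y = l by [].
    apply/eqP; rewrite -subr_eq0; apply/eqP/He; first exact: LB.
    rewrite -(subrK x y) -addrA (splitr e); apply: le_lt_trans (ler_normD _ _) _.
    by apply: ltrD => //; move: xy; rewrite -ball_normE /= distrC.
  exists (ball x (e / 2), setT).
    by split=> /=; [by apply: nbhsx_ballx; rewrite divr_gt0 | exact: filterT].
  move=> [y n] /= [xy _] Ly; case: nol; exists y; split=> //.
  by move: xy; rewrite -ball_normE.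
move=> N _ /(_ N (leqnn N)) gC.
have gbound l : L l -> `|g l| <= N%:R.
  move=> Ll; pose c := l *m invmx M.
  (* Integer parts of the coordinates on the basis: [g] vanishes at [l0], and [l - l0] has norm at
     most [C]. *)
  pose l0 := \sum_i (Num.floor (c 0 i))%:~R *: row i M.
  have Ll0i i : L ((Num.floor (c 0 i))%:~R *: row i M) by exact: lattice_int.
  have Ll0 : L l0 by exact: lattice_sum.
  have <- : g (l - l0) = g l.
    rewrite gB // gsum // big1 ?subr0 // => i _.
    by rewrite gint // gM mulr0.
  apply: gC; last exact: LB.
  have -> : l - l0 = \sum_i (c 0 i - (Num.floor (c 0 i))%:~R) *: row i M.
    rewrite -{1}(mulmxKV uM l) -/c mulmx_sum_row -sumrB.
    by apply: eq_bigr => i _; rewrite scalerBl.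
  apply: le_trans (ler_norm_sum _ _ _) (ler_sum _ _) => i _.
  rewrite normrZ ler_piMl //.
  have := floor_itv (c 0 i); rewrite intrD1 => /andP[lef ltf].
  by rewrite ger0_norm ?subr_ge0 // lerBlDl ltW.
move=> l Ll; apply/eqP; rewrite -subr_eq0 -/(g l) -normr_le0 leNgt.
apply/negP => gl_gt0.
(* For this multiple of [l] the value of [g] would exceed the bound [N]. *)
pose n := (Num.trunc (N%:R / `|g l|)).+1.
have : N%:R < `|g l| * n%:R by rewrite mulrC -ltr_pdivrMr // truncnS_gt.
rewrite ltNge mulr_natr -normrMn -gnat // gbound // -scaler_nat.
exact: (lattice_int n).
Qed.

End FullLattice.
Lemma continuous_atP (R : realType) (T : topologicalType) (W : normedModType R)
    (f : T -> W) v :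
  {for v, continuous f} <->
  forall e : R, 0 < e -> \forall w \near v, `|f v - f w| < e.
Proof. exact: (@cvgrPdist_lt _ _ _ _ (nbhs_filter v)). Qed.

Section RowTimesMatrix.
Variables (R : realType) (n p : nat) (J : 'M[R]_(n, p)).

Lemma norm_mulmxr_le (v : 'rV[R]_n) : `|v *m J| <= n%:R * `|J| * `|v|.
Proof.
apply/normr_mx_le; first by rewrite !mulr_ge0.
move=> i k; rewrite mxE; apply: le_trans (ler_norm_sum _ _ _) _.
apply: le_trans (ler_sum _ (_ : forall j, xpredT j -> _ <= `|J| * `|v|)) _.
  by move=> j _; rewrite normrM mulrC ler_pM //; exact: coord_le_norm.
by rewrite sumr_const card_ord -[leLHS]mulr_natl mulrA.
Qed.

Lemma mulmxr_continuous : continuous (mulmxr J : 'rV[R]_n -> 'rV[R]_p).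
Proof.
move=> v; apply/continuous_atP => e e0.
pose C := n%:R * `|J| + 1; have C0 : 0 < C by rewrite ltr_wpDl // mulr_ge0.
have : \forall w \near v, `|v - w| < e / C.
  by move: (nbhsx_ballx v (e / C) (divr_gt0 e0 C0)); rewrite -ball_normE.
apply: filterS => w; rewrite ltr_pdivlMr // mulrC => vw.
rewrite /= -mulmxBl; apply: le_lt_trans (norm_mulmxr_le _) _.
by apply: le_lt_trans vw; rewrite ler_wpM2r // lerDl.
Qed.

End RowTimesMatrix.
(** * The action and its quotient *)

Section ComplexCoordinates.
Variables (R : realType) (s t : nat).
Local Notation m := (s + t)%N.
Local Notation V := 'rV[R]_(m + m).
Implicit Types (v w : V) (f g : 'I_m -> R[i]).

Definition cvec f : V :=
  row_mx (\row_i complex.Re (f i)) (\row_i complex.Im (f i)).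

(** Coordinatewise multiplication by [f] on C^(s+t). Row vectors are multiplied on the right, hence
    the minus sign in the lower left block. *)
Definition multmx f : 'M[R]_(m + m) :=
  block_mx (diag_mx (\row_i complex.Re (f i))) (diag_mx (\row_i complex.Im (f i)))
    (- diag_mx (\row_i complex.Im (f i))) (diag_mx (\row_i complex.Re (f i))).

Lemma zcoord_cvec f i : zcoord (cvec f) i = f i.
Proof.
by rewrite /zcoord row_mxEl row_mxEr !mxE; case: (f i).
Qed.

Lemma zcoord_inj v w : zcoord v =1 zcoord w -> v = w.
Proof.
move=> vw; apply/rowP => k; rewrite -(splitK k).
by case: (fintype.split k) => i /=; have [] := vw i.
Qed.

Lemma zcoordD v w i : zcoord (v + w) i = zcoord v i + zcoord w i.
Proof. by rewrite /zcoord !mxE. Qed.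

Lemma zcoordN v i : zcoord (- v) i = - zcoord v i.
Proof. by rewrite /zcoord !mxE. Qed.

Lemma zcoordB v w i : zcoord (v - w) i = zcoord v i - zcoord w i.
Proof. by rewrite zcoordD zcoordN. Qed.

Lemma zcoord_multmx v f i : zcoord (v *m multmx f) i = f i * zcoord v i.
Proof.
rewrite -[v in LHS]hsubmxK mul_row_block /zcoord row_mxEl row_mxEr.
rewrite mulmxN !mul_mx_diag !mxE; case: (f i) => a b /=.
by apply/eqP; rewrite eq_complex /=; apply/andP; split; apply/eqP; ring.
Qed.

Lemma cabs_zcoord v i : cabs (zcoord v i) <= 2 * `|v|.
Proof.
apply: le_trans (ler_cabs_ReIm _) _.
by rewrite mulr_natl mulr2n lerD //; exact: coord_le_norm.
Qed.

Lemma norm_zcoord_le v B : 0 <= B -> (forall i, cabs (zcoord v i) <= B) -> `|v| <= B.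
Proof.
move=> B0 vB; apply/normr_mx_le => // i k; rewrite ord1 -(splitK k).
case: (fintype.split k) => j /=; apply: le_trans (vB j).
  exact: le_trans (ler_Re_cabs (zcoord v j)).
exact: le_trans (ler_Im_cabs (zcoord v j)).
Qed.

Definition cindex (k : 'I_(m + m)) : 'I_m :=
  match fintype.split k with inl i => i | inr i => i end.

Lemma cindexl i : cindex (lshift m i) = i.
Proof. by rewrite /cindex (unsplitK (inl _)). Qed.

Lemma cindexr i : cindex (rshift m i) = i.
Proof. by rewrite /cindex (unsplitK (inr _)). Qed.

Lemma multmx_eq0 f k l : cindex k != cindex l -> multmx f k l = 0.
Proof.
rewrite -(splitK k) -(splitK l).
case: (fintype.split k) => i; case: (fintype.split l) => j /=;
rewrite ?cindexl ?cindexr => /negPf ij;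
by rewrite ?(block_mxEul, block_mxEur, block_mxEdl, block_mxEdr) !mxE ij ?oppr0 ?mulr0n ?oppr0.
Qed.

(** On each complex line, multiplication by a number is a rotation scaled by its absolute value. The
    invariance of the metric rests on this. *)
Lemma multmx_mul_tr f : multmx f *m (multmx f)^T =
  diag_mx (\row_k cabs (f (cindex k)) ^+ 2).
Proof.
rewrite /multmx tr_block_mx mulmx_block; apply/matrixP => k l.
rewrite !linearN /= !tr_diag_mx.
rewrite -(splitK k) -(splitK l).
case: (fintype.split k) => i; case: (fintype.split l) => j /=;
rewrite ?(block_mxEul, block_mxEur, block_mxEdl, block_mxEdr) ?mulmxN ?mulNmx !mul_mx_diag !mxE;
rewrite ?cindexl ?cindexr ?(inj_eq (@lshift_inj _ _)) ?(inj_eq (@rshift_inj _ _)) ?eq_lrshift ?eq_rlshift ?mulr0n;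
  have [->|ij] := eqVneq i j; rewrite ?mulr1n ?mulr0n ?sqr_cabs; ring.
Qed.

End ComplexCoordinates.

(** * The affine action and its proper discontinuity *)

Section OTAction.
Variables (R : realType) (K : fieldExtType rat) (s t : nat).
Hypothesis s_gt0 : (0 < s)%N.
Variable sigma : 'I_(s + t + t) -> {rmorphism K -> R[i]}.
Hypothesis Hsigma : lists_embeddings sigma.
Variable U : set K.
Hypothesis HU : admissible sigma U.

Local Notation m := (s + t)%N.
Local Notation V := 'rV[R]_(m + m).
Local Notation sg i := (sigma (lshift t i)).
Local Notation HC := (@HsCt R s t).
Implicit Types (u a : K) (v w z : V).

Let Upos u : U u -> positive_unit sigma u. Proof. by case: HU => + _ _ _ _; apply. Qed.
Let U1 : U 1. Proof. by case: HU. Qed.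
Let UM u u' : U u -> U u' -> U (u * u'). Proof. by case: HU => _ _ + _ _; apply. Qed.
Let UV u : U u -> U u^-1. Proof. by case: HU => _ _ _ + _; apply. Qed.
Let UL : full_lattice [set lsubmx (ell sigma u) | u in U]. Proof. by case: HU. Qed.

Lemma U_integer u : U u -> integer u. Proof. by case/Upos. Qed.
Lemma U_neq0 u : U u -> u != 0. Proof. by case/Upos. Qed.

Definition act u a v : V := v *m multmx (fun i => sg i u) + cvec (fun i => sg i a).

Lemma zcoord_act u a v i : zcoord (act u a v) i = sg i u * zcoord v i + sg i a.
Proof. by rewrite zcoordD zcoord_multmx zcoord_cvec. Qed.

Lemma act1 v : act 1 0 v = v.
Proof. by apply: zcoord_inj => i; rewrite zcoord_act rmorph1 rmorph0 mul1r addr0. Qed.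

Lemma actM u a u' a' v : act u a (act u' a' v) = act (u * u') (u * a' + a) v.
Proof.
apply: zcoord_inj => i; rewrite !zcoord_act !rmorphM rmorphD rmorphM.
by rewrite mulrDr addrA mulrA.
Qed.

Lemma actK u a v : u != 0 -> act u^-1 (- (u^-1 * a)) (act u a v) = v.
Proof. by move=> u0; rewrite actM mulVf // subrr act1. Qed.

Lemma act_continuous u a : continuous (act u a).
Proof.
move=> v; apply/continuous_atP => e e0.
have /continuous_atP/(_ e e0) := @mulmxr_continuous R _ _ (multmx (fun i => sg i u)) v.
by apply: filterS => w; rewrite /act opprD addrACA subrr addr0.
Qed.

Definition ypart (i : 'I_s) v : R := complex.Im (zcoord v (lshift t i)).

Lemma ypart_continuous i : continuous (ypart i).
Proof. exact: (@coord_continuous R 1 (m + m) 0 (rshift m (lshift t i))). Qed.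

(** At a real place the translation is real and a positive unit acts by a positive factor. *)
Lemma ypart_act u a v i : U u ->
  ypart i (act u a v) = cabs (sg (lshift t i) u) * ypart i v.
Proof.
move=> Uu; rewrite /ypart zcoord_act [in LHS](positive_unit_cabs Hsigma i (Upos Uu)).
rewrite (sigma_real Hsigma i a); case: (zcoord v _) => x y /=.
by rewrite mul0r !addr0.
Qed.

Lemma cabs_U_gt0 u i : U u -> 0 < cabs (sg i u).
Proof. by move=> Uu; rewrite cabs_gt0 fmorph_eq0 U_neq0. Qed.

Lemma act_HsCt u a v : U u -> HC v -> HC (act u a v).
Proof.
move=> Uu Hv i; rewrite -/(ypart i _) ypart_act // mulr_gt0 ?cabs_U_gt0 //.
exact: Hv.
Qed.

Lemma HsCt_open : open HC.
Proof.
rewrite openE => v Hv; suff : nbhs v (fun w => forall i, 0 < ypart i w) by [].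
apply: (filter_forall (nbhs_filter v)) => i.
have /continuous_atP/(_ _ (Hv i)) := @ypart_continuous i v.
by apply: filterS => w; rewrite ltr_distlC subrr => /andP[].
Qed.

Definition logy v : 'rV[R]_s := \row_i ln (ypart i v).

Lemma logy_continuous v : HC v -> {for v, continuous logy}.
Proof.
move=> Hv; apply/continuous_atP => e e0.
suff : \forall w \near v, forall i, `|logy v 0 i - logy w 0 i| < e.
  apply: filterS => w H; apply/normr_mx_lt => // i j.
  by rewrite ord1 !mxE; have := H j; rewrite !mxE.
apply: (filter_forall (nbhs_filter v)) => i.
have ci : {for v, continuous (fun w => ln (ypart i w))}.
  apply: continuous_comp; first exact: ypart_continuous.
  by apply: continuous_ln; exact: Hv.
by move/continuous_atP: ci => /(_ _ e0); apply: filterS => w; rewrite !mxE.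
Qed.

Definition Ulog u : 'rV[R]_s := lsubmx (ell sigma u).

Lemma UlogE u i : Ulog u 0 i = ln (cabs (sg (lshift t i) u)).
Proof. by rewrite mxE ellE (unsplitK (inl _)). Qed.

(** In logarithmic coordinates the group acts through translations by the lattice of [U], and
    integers act trivially. *)
Lemma logy_act u a v : U u -> HC v -> logy (act u a v) = Ulog u + logy v.
Proof.
move=> Uu Hv; apply/rowP => i; rewrite [in RHS]mxE UlogE !mxE ypart_act //.
by rewrite lnM // posrE ?cabs_U_gt0 //; exact: Hv.
Qed.

Lemma UlogM u u' : U u -> U u' -> Ulog (u * u') = Ulog u + Ulog u'.
Proof.
move=> Uu Uu'; apply/rowP => i; rewrite [in RHS]mxE !UlogE rmorphM cabsM.
by rewrite lnM // posrE cabs_U_gt0.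
Qed.

Lemma Ulog1 : Ulog 1 = 0.
Proof. by apply/rowP => i; rewrite UlogE rmorph1 cabs1 ln1 mxE. Qed.

Lemma UlogV u : U u -> Ulog u^-1 = - Ulog u.
Proof.
move=> Uu; apply/eqP; rewrite -addr_eq0 -UlogM //; last exact: UV.
by rewrite mulVf ?Ulog1 // U_neq0.
Qed.

Lemma Ulog_inj u u' : U u -> U u' -> Ulog u = Ulog u' -> u = u'.
Proof.
move=> Uu Uu' uu'; apply: (positive_unit_eq Hsigma s_gt0) => [||i].
- exact: Upos.
- exact: Upos.
apply: ln_inj; rewrite ?posrE ?cabs_U_gt0 //.
by rewrite -!UlogE uu'.
Qed.

Lemma Ulog_discrete : exists2 e : R, 0 < e &
  forall u u', U u -> U u' -> `|Ulog u - Ulog u'| < e -> u = u'.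
Proof.
have [e e0 He] := lattice_discrete UL; exists e => // u u' Uu Uu' ue.
apply: Ulog_inj => //; apply/eqP; rewrite -subr_eq0; apply/eqP/He => //.
exists (u * u'^-1); first by apply: UM => //; exact: UV.
by rewrite -/(Ulog _) UlogM ?UlogV //; exact: UV.
Qed.

(* Freeness and proper discontinuity of the action in one statement: [z = w]
   gives the evenly covered neighbourhoods, the general case Hausdorffness. *)
Lemma act_near_unique z w : HC z -> HC w -> exists2 e : R, 0 < e &
  forall u a v u' a' v', U u -> U u' -> integer a -> integer a' ->
    HC v -> HC v' ->
    `|v - z| < e -> `|act u a v - w| < e -> `|v' - z| < e ->
    `|act u' a' v' - w| < e -> u = u' /\ a = a'.
Proof.
move=> Hz Hw; have [d d0 Hd] := Ulog_discrete.
have near_log x : HC x -> exists2 e : R, 0 < e &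
    forall v, `|v - x| < e -> `|logy v - logy x| < d / 4.
  move=> Hx; have /continuous_atP/(_ (d / 4)) := logy_continuous Hx.
  rewrite divr_gt0 // => /(_ isT) /nbhs_ballP[e e0 eP]; exists e => // v ve.
  by rewrite distrC; apply: eP; rewrite -ball_normE /= distrC.
have [e1 e10 E1] := near_log z Hz; have [e2 e20 E2] := near_log w Hw.
pose e3 := Num.min e1 e2.
have e30 : 0 < e3 by rewrite lt_min e10 e20.
(* [Ulog u] is the difference of [logy] at the image and at the point, so four errors below [d / 4]
   force equal lattice vectors. *)
have uniq_u u a v u' a' v' : U u -> U u' -> HC v -> HC v' ->
    `|v - z| < e3 -> `|act u a v - w| < e3 -> `|v' - z| < e3 ->
    `|act u' a' v' - w| < e3 -> u = u'.
  move=> Uu Uu' Hv Hv'; rewrite !lt_min.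
  move=> /andP[/E1 a1 _] /andP[_ /E2 a2] /andP[/E1 a3 _] /andP[_ /E2 a4].
  rewrite logy_act // in a2; rewrite logy_act // in a4.
  apply: Hd => //.
  have -> : Ulog u - Ulog u' = (Ulog u + logy v - logy w)
     - (Ulog u' + logy v' - logy w) - (logy v - logy z) + (logy v' - logy z).
    by apply/rowP => i; rewrite !mxE; ring.
  have -> : d = d / 4 + d / 4 + d / 4 + d / 4 by field.
  apply: le_lt_trans (ler_normD _ _) (ltrD _ a3).
  apply: le_lt_trans (ler_normB _ _) (ltrD _ a1).
  exact: le_lt_trans (ler_normB _ _) (ltrD a2 a4).
(* A reference element fixes the only possible [u], so that its embeddings are bounded before the
   final radius is chosen; if there is none, the claim is vacuous at radius [e3]. *)
have [[u0 [a0 [v0 [Uu0 Hv0 vz0 vw0]]]]|none] := pselect (exists u0 a0 v0,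
    [/\ U u0, HC v0, `|v0 - z| < e3 & `|act u0 a0 v0 - w| < e3]); last first.
  exists e3 => // u a v u' a' v' Uu _ _ _ Hv _ vz vw; case: none.
  by exists u, a, v.
pose S := \sum_i cabs (sg i u0).
have S0 : 0 <= S by apply: sumr_ge0 => i _; exact: cabs_ge0.
(* With this radius every embedding of [a - a'] is below 4 e (1 + S) <= 1 in absolute value, as
   [sigma_discrete] demands. *)
pose e := Num.min e3 (1 / (4 * (1 + S))).
have e0 : 0 < e by rewrite lt_min e30 divr_gt0 // mulr_gt0 // ltr_wpDr.
have le_e3 x : x < e -> x < e3 by rewrite lt_min => /andP[].
exists e => // u a v u' a' v' Uu Uu' ia ia' Hv Hv' vz vw vz' vw'.
have Du := uniq_u u a v _ _ _ Uu Uu0 Hv Hv0 (le_e3 _ vz) (le_e3 _ vw) vz0 vw0.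
have Du' := uniq_u u' a' v' _ _ _ Uu' Uu0 Hv' Hv0 (le_e3 _ vz') (le_e3 _ vw') vz0 vw0.
split; first by rewrite Du Du'.
rewrite {u}Du {u'}Du' in Uu Uu' vw vw' *.
apply/eqP; rewrite -subr_eq0; apply/eqP; apply: (sigma_discrete Hsigma s_gt0).
  exact: integerB.
move=> i; have -> : sg i (a - a') = zcoord ((act u0 a v - w) - (act u0 a' v' - w)) i
    - sg i u0 * zcoord ((v - z) - (v' - z)) i.
  by rewrite !zcoordB !zcoord_act rmorphB; ring.
have bnd x y x' y' : `|x - y : V| < e -> `|x' - y'| < e ->
    cabs (zcoord ((x - y) - (x' - y')) i) < 4 * e.
  move=> xy xy'; apply: le_lt_trans (cabs_zcoord _ _) _.
  rewrite (_ : 4 * e = 2 * (e + e)); last by ring.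
  by rewrite ltr_pM2l //; apply: le_lt_trans (ler_normB _ _) (ltrD _ _).
have leS : cabs (sg i u0) <= S.
  by rewrite /S (bigD1 i) //= lerDl sumr_ge0 // => j _; exact: cabs_ge0.
apply: le_lt_trans (ler_cabsD _ _) _; rewrite cabsN cabsM.
apply: (@lt_le_trans _ _ (4 * e + S * (4 * e))).
  apply: ltr_leD; first exact: bnd.
  by apply: ler_pM; rewrite ?cabs_ge0 // ltW // bnd.
have : e <= 1 / (4 * (1 + S)) by rewrite ge_min lexx orbT.
rewrite ler_pdivlMr ?mulr_gt0 // ?ltr_wpDr //; lra.
Qed.

End OTAction.

(** * The projection to the quotient *)

Section OTQuotient.
Variables (R : realType) (K : fieldExtType rat) (s t : nat).
Hypothesis s_gt0 : (0 < s)%N.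
Variable sigma : 'I_(s + t + t) -> {rmorphism K -> R[i]}.
Hypothesis Hsigma : lists_embeddings sigma.
Variable U : set K.
Hypothesis HU : admissible sigma U.

Local Notation m := (s + t)%N.
Local Notation V := 'rV[R]_(m + m).
Local Notation sg i := (sigma (lshift t i)).
Local Notation HC := (@HsCt R s t).
Local Notation act := (act sigma).
Local Notation X := (OT sigma U).
Implicit Types (u a : K) (v w z : V).

Let U1 : U 1. Proof. by case: HU. Qed.
Let UM u u' : U u -> U u' -> U (u * u'). Proof. by case: HU => _ _ + _ _; apply. Qed.
Let UV u : U u -> U u^-1. Proof. by case: HU => _ _ _ + _; apply. Qed.

Definition HsCt_pt : V := \row__ 1.

Lemma HsCt_ptP : HC HsCt_pt.
Proof. by move=> i; rewrite /= mxE. Qed.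

(* Constant off [H^s x C^t]. *)
Definition OT_pr v : X :=
  orbit_proj (OT_orbit sigma U) (insubd (exist _ HsCt_pt (mem_set HsCt_ptP) : HC) v).

Lemma OT_pr_val (z : HC) : OT_pr (set_val z) = orbit_proj (OT_orbit sigma U) z.
Proof. by rewrite /OT_pr valKd. Qed.

Lemma OT_orbitP (z w : HC) : OT_orbit sigma U z w <->
  exists u a, [/\ U u, integer a & set_val w = act u a (set_val z)].
Proof.
split=> -[u [a [Uu ia zw]]]; exists u, a; split=> //.
  by apply: zcoord_inj => i; rewrite zw zcoord_act.
by move=> i; rewrite zw zcoord_act.
Qed.

Lemma OT_orbit_eq (z w : HC) :
  OT_orbit sigma U z = OT_orbit sigma U w <-> OT_orbit sigma U z w.
Proof.
have refl (x : HC) : OT_orbit sigma U x x.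
  by apply/OT_orbitP; exists 1, 0; split=> //; [exact: integer_int 0 | rewrite act1].
have trans (x y y' : HC) : OT_orbit sigma U x y -> OT_orbit sigma U y y' ->
    OT_orbit sigma U x y'.
  move=> /OT_orbitP[u [a [Uu ia xy]]] /OT_orbitP[u' [a' [Uu' ia' yy']]].
  apply/OT_orbitP; exists (u' * u), (u' * a + a'); split; first exact: UM.
    rewrite -[a']opprK; apply: integerB.
      by apply: integerM => //; exact: (U_integer HU).
    by rewrite -sub0r; apply: integerB => //; exact: integer_int 0.
  by rewrite yy' xy actM.
have sym (x y : HC) : OT_orbit sigma U x y -> OT_orbit sigma U y x.
  move=> /OT_orbitP[u [a [Uu ia xy]]]; apply/OT_orbitP.
  exists u^-1, (- (u^-1 * a)); split; first exact: UV.
    rewrite -sub0r; apply: integerB; first exact: integer_int 0.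
    by apply: integerM => //; apply: (U_integer HU); exact: UV.
  by rewrite xy actK // (U_neq0 HU).
split=> [->|zw]; first exact: refl.
apply/seteqP; split=> x; last exact: trans.
by apply: trans; exact: sym.
Qed.

Lemma OT_prP v w : HC v -> HC w -> OT_pr v = OT_pr w <->
  exists u a, [/\ U u, integer a & w = act u a v].
Proof.
move=> Hv Hw; pose v' : HC := exist _ v (mem_set Hv).
pose w' : HC := exist _ w (mem_set Hw).
rewrite -[v]/(set_val v') -[w]/(set_val w') !OT_pr_val.
by rewrite orbit_projP OT_orbit_eq OT_orbitP.
Qed.

Lemma OT_pr_act u a v : U u -> integer a -> HC v -> OT_pr (act u a v) = OT_pr v.
Proof.
move=> Uu ia Hv; apply/esym/OT_prP => //; last by exists u, a.
exact: (act_HsCt Hsigma HU).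
Qed.

Lemma OT_pr_surj (q : X) : exists2 v, HC v & OT_pr v = q.
Proof.
have [z <-] := orbit_proj_surj q; exists (set_val z); last exact: OT_pr_val.
exact: set_valP.
Qed.

(** The quotient is that of a subtype; since [HsCt] is open, openness can be tested in the ambient
    vector space. *)
Lemma OT_open (Q : set X) : open Q <-> open (HC `&` OT_pr @^-1` Q).
Proof.
have E (B : set V) : set_val @^-1` B = orbit_proj (OT_orbit sigma U) @^-1` Q ->
    HC `&` OT_pr @^-1` Q = HC `&` B.
  move=> OE; apply/seteqP; split=> v [Hv Qv]; split=> //;
    pose v' : HC := exist _ v (mem_set Hv).
    suff : (set_val @^-1` B) v' by [].
    by rewrite OE /= -OT_pr_val.
  have : (orbit_proj (OT_orbit sigma U) @^-1` Q) v' by rewrite -OE.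
  by rewrite /= -OT_pr_val.
split=> [[B oO OE]|oQ].
  by rewrite (E B OE); apply: openI => //; exact: HsCt_open.
exists (HC `&` OT_pr @^-1` Q) => //; apply/seteqP; split=> z /=.
  by rewrite OT_pr_val => -[].
by rewrite OT_pr_val; split=> //; exact: set_valP.
Qed.

Lemma OT_pr_continuous v : HC v -> {for v, continuous OT_pr}.
Proof.
move=> Hv A; rewrite nbhsE => -[Q [oQ Qv] QA].
have /OT_open oQ' := oQ.
apply: filterS (_ : (HC `&` OT_pr @^-1` Q) `<=` _) _.
  by move=> w [_ Qw]; exact: QA.
exact: open_nbhs_nbhs.
Qed.

Lemma OT_pr_open (B : set V) : open B -> B `<=` HC -> open (OT_pr @` B).
Proof.
move=> oO OH; apply/OT_open; rewrite openE => v [Hv [w Ow wv]].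
have [u [a [Uu ia Dw]]] := (OT_prP Hv (OH _ Ow)).1 (esym wv).
have nO : nbhs v (act u a @^-1` B).
  apply: (@act_continuous _ _ _ _ sigma u a v); rewrite -Dw; exact: open_nbhs_nbhs.
have nH : nbhs v HC by apply: open_nbhs_nbhs; split=> //; exact: HsCt_open.
apply: filterS2 nO nH => v' Ov' Hv'; split=> //; exists (act u a v') => //.
exact: OT_pr_act.
Qed.

Lemma OT_pr_nbhs v (A : set V) : HC v -> nbhs v A -> nbhs (OT_pr v) (OT_pr @` A).
Proof.
move=> Hv nA; have oA := open_interior A.
have sub : OT_pr @` (A° `&` HC) `<=` OT_pr @` A.
  by move=> _ [w [Aw _] <-]; exists w => //; exact: interior_subset.
apply: (filterS sub); apply: open_nbhs_nbhs; split; last by exists v.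
by apply: OT_pr_open => [|? []//]; apply: openI => //; exact: HsCt_open.
Qed.

(** With both centres at [z], an element joining two nearby points is compared with the identity. *)
Lemma OT_evenly_covered z : HC z -> exists2 B : set V,
  [/\ open B, B z & B `<=` HC] & {in B &, injective OT_pr}.
Proof.
move=> Hz; have [e e0 He] := act_near_unique s_gt0 Hsigma HU Hz Hz.
exists (HC `&` ball z e).
  split; last by move=> ? [].
    by apply: openI; [exact: HsCt_open | exact: ball_open].
  by split=> //; exact: ballxx.
move=> v w; rewrite !inE -ball_normE /= => -[Hv vz] [Hw wz].
rewrite distrC in vz; rewrite distrC in wz.
move=> /(OT_prP Hv Hw)[u [a [Uu ia Dw]]]; rewrite Dw.
have [-> ->] : u = 1 /\ a = 0; last by rewrite act1.
apply: (He u a v 1 0 v) => //; rewrite ?act1 -?Dw //; exact: integer_int 0.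
Qed.

Lemma OT_hausdorff : hausdorff_space X.
Proof.
rewrite open_hausdorff => p q pq.
have [z Hz Dp] := OT_pr_surj p; have [w Hw Dq] := OT_pr_surj q.
have [e e0 He] := act_near_unique s_gt0 Hsigma HU Hz Hw.
suff [d d0 Hd] : exists2 d, 0 < d & forall u a v, U u -> integer a -> HC v ->
    `|v - z| < d -> `|act u a v - w| < d -> False.
  pose N x := HC `&` ball x d.
  have oN x : open (N x) by apply: openI; [exact: HsCt_open | exact: ball_open].
  exists (OT_pr @` N z, OT_pr @` N w).
    split=> /=; rewrite inE -?Dp -?Dq; [exists z|exists w] => //;
      by split=> //; exact: ballxx.
  split; [by apply: OT_pr_open => // ? [] | by apply: OT_pr_open => // ? []|].
  apply/eqP; rewrite -subset0 => _ [[v [Hv vz] <-] [v' [Hv' v'w]]].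
  move/esym/(OT_prP Hv Hv') => [u [a [Uu ia Dv']]].
  move: vz v'w; rewrite -ball_normE /= ![`|_ - v|]distrC ![`|w - _|]distrC.
  by rewrite Dv'; exact: Hd.
(* At most one group element relates the two balls of radius [e]; it does not carry [z] to [w], so a
   smaller radius excludes it. *)
have [[u0 [a0 [v0 [Uu0 ia0 Hv0 vz0 vw0]]]]|none] := pselect (exists u a v,
    [/\ U u, integer a, HC v, `|v - z| < e & `|act u a v - w| < e]); last first.
  by exists e => // u a v Uu ia Hv vz vw; apply: none; exists u, a, v.
pose d := `|act u0 a0 z - w|.
have d0 : 0 < d.
  rewrite normr_gt0 subr_eq0; apply/eqP => Dw; move/eqP: pq; apply.
  by rewrite -Dp -Dq -Dw OT_pr_act.
have d20 : 0 < d / 2 by rewrite divr_gt0.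
have /continuous_atP/(_ _ d20) := @act_continuous _ _ _ _ sigma u0 a0 z.
move=> /nbhs_ballP[e' /= e'0 He'].
exists (Num.min e (Num.min e' (d / 2))); first by rewrite !lt_min e0 e'0.
move=> u a v Uu ia Hv; rewrite !lt_min => /and3P[vz vz' _] /and3P[vw _ vw'].
have [Du Da] := He _ _ _ _ _ _ Uu Uu0 ia ia0 Hv Hv0 vz vw vz0 vw0.
have := He' v; rewrite -ball_normE /= distrC => /(_ vz'); rewrite -Du -Da => a1.
have : d < d; last by rewrite ltxx.
rewrite {2}(splitr d) {1}/d -Du -Da -(subrK (act u a v) (act u a z)) -addrA.
exact: le_lt_trans (ler_normD _ _) (ltrD _ _).
Qed.

End OTQuotient.

(** * Compactness, connectedness and charts of the quotient *)

Section OTManifold.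
Variables (R : realType) (K : fieldExtType rat) (s t : nat).
Hypothesis s_gt0 : (0 < s)%N.
Variable sigma : 'I_(s + t + t) -> {rmorphism K -> R[i]}.
Hypothesis Hsigma : lists_embeddings sigma.
Variable U : set K.
Hypothesis HU : admissible sigma U.

Local Notation m := (s + t)%N.
Local Notation V := 'rV[R]_(m + m).
Local Notation sg i := (sigma (lshift t i)).
Local Notation HC := (@HsCt R s t).
Local Notation act := (act sigma).
Local Notation X := (OT sigma U).
Local Notation pr := (@OT_pr R K s t sigma U).
Local Notation atlas := (OT_atlas sigma U).
Implicit Types (u a : K) (v w z : V) (c : chart R (m + m) X).

Let UV u : U u -> U u^-1. Proof. by case: HU => _ _ _ + _; apply. Qed.
Let U1 : U 1. Proof. by case: HU. Qed.

(** The compact set [D] meets every orbit: a unit brings [logy] within [B1] of 0, then an integer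
    translation bounds the real parts at the real places and the whole coordinates at the complex
    ones. *)
Lemma OT_compact : compact [set: X].
Proof.
have [B1 HB1] : exists B : R, forall x : 'rV[R]_s, exists2 u, U u & `|x - Ulog sigma u| <= B.
  have [B HB] : exists B : R, forall x : 'rV[R]_s,
      exists2 l, [set lsubmx (ell sigma u) | u in U] l & `|x - l| <= B.
    by apply: lattice_cobounded; case: HU.
  by exists B => x; have [_ [u Uu <-] xu] := HB x; exists u.
have [B2 HB2] := sigma_approx Hsigma.
have B20 : 0 <= B2.
  have [//|a _ /(_ (lshift t (Ordinal s_gt0)))] := HB2 (fun=> 0).
  by apply: le_trans; exact: cabs_ge0.
(* [B2] bounds the error left by the translation; [expR B1] bounds the imaginary parts at the real
   places, which translations fix. *)
pose C := B2 + expR B1.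
have C0 : 0 <= C by rewrite addr_ge0 ?expR_ge0.
pose D : set V := [set v | `|v| <= C] `&`
  \bigcap_(i in [set: 'I_s]) [set v | expR (- B1) <= ypart i v].
have DH : D `<=` HC.
  by move=> v [_ vB] i; apply: lt_le_trans (vB i I); exact: expR_gt0.
have cD : compact D.
  apply: bounded_closed_compact.
    by exists C; split=> [|r Cr x [/= xC _]]; [exact: num_real | apply: le_trans xC (ltW _)].
  apply: closedI.
    rewrite (_ : [set x | _] = closed_ball_ (@Num.norm R _) (0 : V) C).
      exact: closed_closed_ball_.
    by apply/seteqP; split=> x /=; rewrite /closed_ball_ /= sub0r normrN.
  apply: closed_bigI => i _.
  apply: (@closed_comp _ _ (@ypart R s t i) [set y | expR (- B1) <= y]).
    by move=> v _; exact: ypart_continuous.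
  exact: closed_ge.
suff <- : pr @` D = [set: X].
  apply: continuous_compact cD; apply: continuous_in_subspaceT => v.
  by rewrite inE => /DH Hv; exact: (OT_pr_continuous Hv).
apply/seteqP; split=> // q _; have [v Hv <-] := OT_pr_surj q.
have [u Uu vu] := HB1 (logy v).
pose v1 := act u^-1 0 v.
have Hv1 : HC v1 by apply: (act_HsCt Hsigma HU) => //; exact: UV.
have lv1 : logy v1 = logy v - Ulog sigma u.
  rewrite (logy_act Hsigma HU) //; last exact: UV.
  by rewrite (UlogV HU) // addrC.
have yv1 i : expR (- B1) <= ypart i v1 <= expR B1.
  have := le_trans (coord_le_norm _ 0 i) vu; rewrite -lv1 mxE ler_norml.
  have y0 : 0 < ypart i v1 by exact: Hv1.
  by rewrite -[ypart i v1](lnK _) ?posrE // !ler_expR lnK ?posrE.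
(* Integers embed as real numbers at the real places, so only the real part can be approximated
   there. *)
pose x (i : 'I_m) : R[i] :=
  if fintype.split i is inl _ then (complex.Re (zcoord v1 i))%:C else zcoord v1 i.
have xl i : x (lshift t i) = (complex.Re (zcoord v1 (lshift t i)))%:C.
  by rewrite /x (unsplitK (inl _)).
have xr j : x (rshift s j) = zcoord v1 (rshift s j) by rewrite /x (unsplitK (inr _)).
have [i|a ia aB] := HB2 x; first by rewrite xl.
have iN (b : K) : integer b -> integer (- b).
  by move=> ib; rewrite -sub0r; apply: integerB => //; exact: integer_int 0.
have i0 : integer (0 : K) by exact: integer_int 0.
exists (act 1 (- a) v1); last first.
  rewrite (OT_pr_act Hsigma HU) //; last exact: iN.
  by rewrite (OT_pr_act Hsigma HU) //; exact: UV.
split=> /=; last first.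
  move=> i _ /=; rewrite (ypart_act Hsigma HU) // rmorph1 cabs1 mul1r.
  by case/andP: (yv1 i).
apply: norm_zcoord_le => // i.
have -> : zcoord (act 1 (- a) v1) i = - (sg i a - x i) + (zcoord v1 i - x i).
  by rewrite zcoord_act rmorph1 rmorphN; ring.
apply: le_trans (ler_cabsD _ _) _; rewrite cabsN; apply: lerD; first exact: aB.
rewrite -(splitK i); case: (fintype.split i) => j /=; last first.
  by rewrite xr subrr /cabs normr0 expR_ge0.
apply: le_trans (ler_cabs_ReIm _) _; rewrite xl.
have /andP[_] := yv1 j; rewrite /ypart.
have := Hv1 j; case: (zcoord _ _) => p r /= r0 rB.
by rewrite subrr normr0 add0r oppr0 addr0 ger0_norm // ltW.
Qed.

Lemma HsCt_segment v w (r : R) : HC v -> HC w -> 0 <= r <= 1 -> HC (v + r *: (w - v)).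
Proof.
move=> Hv Hw /andP[r0 r1] i; have := Hv i; have := Hw i.
rewrite /= !mxE; set x := w _ _; set y := v _ _ => x0 y0; nra.
Qed.

Lemma HsCt_connected : connected HC.
Proof.
pose z := @HsCt_pt R s t; have Hz : HC z := @HsCt_ptP R s t.
pose seg w := (fun r : R => z + r *: (w - z)) @` `[0, 1]%classic.
have -> : HC = \bigcup_(w in HC) seg w.
  apply/seteqP; split=> [w Hw|v [w Hw [r]]].
    exists w => //; exists 1; first by rewrite /= in_itv /= ler01 lexx.
    by rewrite scale1r addrC subrK.
  by rewrite /= in_itv /= => r01 <-; exact: HsCt_segment.
apply: bigcup_connected.
  exists z => w _; exists 0; first by rewrite /= in_itv /= lexx ler01.
  by rewrite scale0r addr0.
move=> w _; apply: connected_continuous_connected; first exact: segment_connected.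
apply: continuous_subspaceT => r; apply/continuous_atP => e e0.
have c0 : 0 < `|w - z| + 1 by rewrite ltr_wpDl.
have : \forall q \near r, `|r - q| < e / (`|w - z| + 1).
  move: (nbhsx_ballx r (e / (`|w - z| + 1)) (divr_gt0 e0 c0)).
  by rewrite -ball_normE.
apply: filterS => q; rewrite ltr_pdivlMr // => rq.
rewrite opprD addrACA subrr add0r -scalerBl normrZ.
by apply: le_lt_trans rq; rewrite ler_wpM2l // lerDl.
Qed.

Lemma OT_connected : connected [set: X].
Proof.
suff <- : pr @` HC = [set: X].
  apply: connected_continuous_connected; first exact: HsCt_connected.
  apply: continuous_in_subspaceT => v; rewrite inE => Hv.
  exact: (OT_pr_continuous Hv).
by apply/seteqP; split=> // q _; have [v Hv <-] := OT_pr_surj q; exists v.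
Qed.

(** The chart is the inverse of [pr] on an evenly covered open set; its continuity is the openness
    of [pr]. *)
Lemma OT_chart_at z : HC z -> exists2 c, atlas c & ccod c z.
Proof.
move=> Hz; have [B [oB Bz BH] prI] := OT_evenly_covered s_gt0 Hsigma HU Hz.
pose cm (q : X) : V := xget z [set v | B v /\ pr v = q].
have cmP q : (pr @` B) q -> B (cm q) /\ pr (cm q) = q.
  by move=> [v Bv vq]; apply: (@xgetPex _ z [set v | B v /\ pr v = q]); exists v.
have cmK v : B v -> cm (pr v) = v.
  move=> Bv; have [Bc prc] : B (cm (pr v)) /\ pr (cm (pr v)) = pr v.
    by apply: cmP; exists v.
  by apply: prI; rewrite ?inE.
have odom : open (pr @` B) by exact: (OT_pr_open Hsigma HU).
have cm_cont : {within pr @` B, continuous cm}.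
  apply: continuous_in_subspaceT => _ /set_mem[v Bv <-] A.
  rewrite cmK // => nA.
  have nAB : nbhs v (A `&` B) by apply: filterI => //; exact: open_nbhs_nbhs.
  apply: filterS (OT_pr_nbhs Hsigma HU (BH _ Bv) nAB) => _ [w [Aw Bw] <-] /=.
  by rewrite cmK.
have pr_cont : {within B, continuous pr}.
  apply: continuous_in_subspaceT => v; rewrite inE => Bv.
  by apply: OT_pr_continuous; exact: BH.
exists (@Chart R (m + m) X (pr @` B) B cm pr odom oB
  (fun q qB => (cmP q qB).1) (fun v Bv => ex_intro2 _ _ v Bv erefl)
  (fun q qB => (cmP q qB).2) cmK cm_cont pr_cont) => //.
by split=> //= w _; exact: OT_pr_val.
Qed.

Lemma atlas_HsCt c v : atlas c -> ccod c v -> HC v.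
Proof. by case=> + _; apply. Qed.

Lemma atlas_cinv c v : atlas c -> ccod c v -> cinv c v = pr v.
Proof.
move=> Ac cv; have Hv := atlas_HsCt Ac cv; case: Ac => _ Ac.
pose v' : HC := exist _ v (mem_set Hv).
by rewrite -[v]/(set_val v') Ac // OT_pr_val.
Qed.

Lemma cmap_lift c q : atlas c -> cdom c q -> HC (cmap c q) /\ pr (cmap c q) = q.
Proof.
move=> Ac cq; have cc := cmap_cod cq; split; first exact: atlas_HsCt cc.
by rewrite -(atlas_cinv Ac cc) cmapK.
Qed.

(** Each point of the overlap has its own group element; continuity of the transition and
    [act_near_unique] show that it does not change near [v]. *)
Lemma transition_act c c' v : atlas c -> atlas c' -> overlap c c' v ->
  exists u a, [/\ U u, integer a & \forall w \near v,
    overlap c c' w /\ transition c c' w = act u a w].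
Proof.
move=> Ac Ac' [cv c'v]; pose v' := transition c c' v.
have Hv := atlas_HsCt Ac cv; have [Hv' prv'] := cmap_lift Ac' c'v.
have [u [a [Uu ia Dv']]] : exists u a, [/\ U u, integer a & v' = act u a v].
  by apply/(OT_prP HU Hv Hv'); rewrite prv' (atlas_cinv Ac cv).
exists u, a; split=> //.
have [e e0 He] := act_near_unique s_gt0 Hsigma HU Hv Hv'.
have cinv_c : {for v, continuous (cinv c)}.
  have : {in ccod c, continuous (cinv c)}.
    rewrite -continuous_open_subspace; first exact: cinv_continuous.
    exact: ccod_open.
  by move=> /(_ v (mem_set cv)).
have cmap_c : {for cinv c v, continuous (cmap c')}.
  have : {in cdom c', continuous (cmap c')}.
    rewrite -continuous_open_subspace; first exact: cmap_continuous.
    exact: cdom_open.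
  by move=> /(_ _ (mem_set c'v)).
have tr_c : {for v, continuous (transition c c')} by exact: continuous_comp.
have n1 : \forall w \near v, ccod c w.
  by apply: open_nbhs_nbhs; split=> //; exact: ccod_open.
have n2 : \forall w \near v, cdom c' (cinv c w).
  by apply: cinv_c; apply: open_nbhs_nbhs; split=> //; exact: cdom_open.
have /continuous_atP/(_ e e0) n3 := tr_c.
have n4 : \forall w \near v, `|v - w| < e.
  by move: (nbhsx_ballx v e e0); rewrite -ball_normE.
have FF : Filter (nbhs v) := nbhs_filter v.
have n12 := @filterI _ _ FF _ _ n1 n2; have n34 := @filterI _ _ FF _ _ n3 n4.
apply: (@filterS2 _ _ FF _ _ _ _ n12 n34) => w [cw c'w] [tw vw].
split=> //; have Hw := atlas_HsCt Ac cw; have [Hw' prw'] := cmap_lift Ac' c'w.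
have [u' [a' [Uu' ia' Dw']]] :
    exists u' a', [/\ U u', integer a' & transition c c' w = act u' a' w].
  by apply/(OT_prP HU Hw Hw'); rewrite prw' (atlas_cinv Ac cw).
rewrite distrC in tw; rewrite distrC in vw.
have [-> ->] : u = u' /\ a = a'; last by [].
apply: (He u a v u' a' w) => //; rewrite ?subrr ?normr0 //.
  by rewrite -Dv' subrr normr0.
by rewrite -Dw'.
Qed.

End OTManifold.
(** * Smooth functions and partial derivatives *)

Lemma near_eq_differentiable (R : numFieldType) (V W : normedModType R)
    (f g : V -> W) (x : V) :
  (\forall y \near x, f y = g y) -> differentiable f x -> differentiable g x.
Proof.
move=> fg df; have fgx : f x = g x := nbhs_singleton fg.
have [dfc fE] := (diff_locallyP x f).1 df.
have fg0 : \forall y \near (0 : V), f (y + x) = g (y + x).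
  by move: fg; rewrite (near_shift 0 x); apply: filterS => y /=; rewrite subr0.
have gE : g \o shift x = cst (g x) + 'd f x +o_ (0 : V) id.
  apply/eqaddoP => e e0.
  have /eqaddoP/(_ e e0) := fE; apply: filterS2 fg0 => y fgy.
  by rewrite -fgx !fctE /= fgy.
by apply/diff_locallyP; rewrite (diff_unique dfc gE).
Qed.
Section SmoothOn.
Variables (R : realType) (n : nat) (A : set 'rV[R]_n).
Hypothesis oA : open A.
Local Notation V := 'rV[R]_n.

Lemma open_near_eq (W : Type) (f g : V -> W) v :
  A v -> {in A, f =1 g} -> nbhs v [set w | f w = g w].
Proof.
move=> Av fg; apply: filterS (_ : nbhs v A); last exact: open_nbhs_nbhs.
by move=> w /mem_set/fg.
Qed.

Lemma partial_eq_on (W : normedModType R) (f g : V -> W) i v :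
  A v -> {in A, f =1 g} -> partial i f v = partial i g v.
Proof. by move=> Av fg; apply: near_eq_derive; exact: open_near_eq. Qed.

Lemma differentiable_eq_on (W : normedModType R) (f g : V -> W) v :
  A v -> {in A, f =1 g} -> differentiable f v -> differentiable g v.
Proof. by move=> Av fg; apply: near_eq_differentiable; exact: open_near_eq. Qed.

(* Coinduction: a class of functions differentiable on [A] and stable under
   partial derivatives consists of smooth functions. *)
Lemma smooth_on_coind (P : (V -> R) -> Prop) :
    (forall f v, P f -> A v -> differentiable f v) ->
    (forall f i, P f -> exists2 g, P g & {in A, partial i f =1 g}) ->
  forall f, P f -> smooth_on A f.
Proof.
move=> Pdiff Ppartial f Pf l.
have [g Pg lg] : exists2 g, P g & {in A, foldr (@partial R n R) f l =1 g}.
  elim: l => [|i l [g Pg lg]] /=; first by exists f.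
  have [h Ph gh] := Ppartial g i Pg; exists h => // v Av.
  by rewrite -gh //; apply: partial_eq_on => //; rewrite inE in Av.
move=> v Av; apply: (@differentiable_eq_on _ g) => //.
  by move=> w Aw; rewrite lg.
exact: Pdiff.
Qed.

Lemma smooth_on_differentiable (f : V -> R) v :
  smooth_on A f -> A v -> differentiable f v.
Proof. by move=> /(_ [::]); apply. Qed.

Lemma smooth_on_partial (f : V -> R) i : smooth_on A f -> smooth_on A (partial i f).
Proof. by move=> sf l v Av; rewrite -foldr_rcons; exact: sf. Qed.

Lemma smooth_on_eq (f g : V -> R) :
  {in A, f =1 g} -> smooth_on A f -> smooth_on A g.
Proof.
move=> fg sf; apply: (smooth_on_coind (P := fun g => exists2 f,
  {in A, f =1 g} & smooth_on A f)); last by exists f.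
  move=> {sf fg} {}g v [{}f fg sf] Av; apply: differentiable_eq_on fg _ => //.
  exact: smooth_on_differentiable.
move=> {sf fg} {}g i [{}f fg sf]; exists (partial i g) => //.
exists (partial i f); last exact: smooth_on_partial.
by move=> v Av; apply: partial_eq_on => //; rewrite inE in Av.
Qed.

Lemma smooth_onS (B : set V) (f : V -> R) : B `<=` A -> smooth_on A f -> smooth_on B f.
Proof. by move=> BA sf l v /BA; exact: sf. Qed.

Lemma partialD (f g : V -> R) i v : differentiable f v -> differentiable g v ->
  partial i (fun w => f w + g w) v = partial i f v + partial i g v.
Proof. by move=> df dg; apply: deriveD; exact: diff_derivable. Qed.

Lemma partialZ (f : V -> R) k i v : differentiable f v ->
  partial i (fun w => k * f w) v = k * partial i f v.
Proof. by move=> df; apply: (deriveZ k); exact: diff_derivable. Qed.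

Lemma smooth_on_lincomb (f g : V -> R) k l : smooth_on A f -> smooth_on A g ->
  smooth_on A (fun v => k * f v + l * g v).
Proof.
move=> sf sg; apply: (smooth_on_coind (P := fun h => exists f g,
  [/\ smooth_on A f, smooth_on A g & h = fun v => k * f v + l * g v]));
  last by exists f, g.
  move=> {f g sf sg} _ v [f [g [sf sg ->]]] Av.
  apply: (@differentiableD _ _ _ (k *: f) (l *: g));
    by apply/differentiableZ/smooth_on_differentiable.
move=> {f g sf sg} _ i [f [g [sf sg ->]]].
exists (fun v => k * partial i f v + l * partial i g v).
  by exists (partial i f), (partial i g); split=> //; exact: smooth_on_partial.
move=> v; rewrite inE => Av.
have df := smooth_on_differentiable sf Av.
have dg := smooth_on_differentiable sg Av.
rewrite -!partialZ //; apply: partialD; exact: differentiableZ.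
Qed.

Lemma smooth_onB (f g : V -> R) : smooth_on A f -> smooth_on A g ->
  smooth_on A (fun v => f v - g v).
Proof.
move=> sf sg; apply: smooth_on_eq (smooth_on_lincomb 1 (-1) sf sg).
by move=> v _; rewrite mul1r mulN1r.
Qed.

Lemma partial_cst (W : normedModType R) (k : W) i v :
  @partial R n W i (fun=> k) v = 0.
Proof. exact: derive_cst. Qed.

Lemma smooth_on_cst (k : R) : smooth_on A (fun=> k).
Proof.
apply: (smooth_on_coind (P := fun f => exists k, f = fun=> k)); last by exists k.
  by move=> _ v [{}k ->] _; exact: differentiable_cst.
move=> _ i [{}k ->]; exists (fun=> 0); first by exists 0.
by move=> v _; exact: partial_cst.
Qed.

Lemma smooth_onZ (f : V -> R) k : smooth_on A f -> smooth_on A (fun v => k * f v).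
Proof.
move=> sf; apply: smooth_on_eq (smooth_on_lincomb k 0 sf sf).
by move=> v _; rewrite mul0r addr0.
Qed.

Lemma differentiable_mulmxr p (J : 'M[R]_(n, p)) v :
  differentiable (fun w : V => w *m J) v.
Proof.
apply: (@linear_differentiable _ _ _ (mulmxr J)); exact: mulmxr_continuous.
Qed.

Lemma differentiable_affine p (J : 'M[R]_(n, p)) b v :
  differentiable (fun w : V => w *m J + b) v.
Proof.
apply: (@differentiableD _ _ _ (mulmxr J) (cst b)).
  exact: differentiable_mulmxr.
exact: differentiable_cst.
Qed.

Lemma jacobian_affine p (J : 'M[R]_(n, p)) b v :
  'J (fun w : V => w *m J + b) v = J.
Proof.
have dJ : differentiable (mulmxr J : V -> 'rV_p) v by exact: differentiable_mulmxr.
have dl : 'd (mulmxr J : V -> 'rV_p) v = mulmxr J :> (V -> 'rV_p).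
  by apply: (@diff_lin R V 'rV_p (mulmxr J)); exact: mulmxr_continuous.
have db : differentiable (cst b : V -> 'rV_p) v by exact: differentiable_cst.
have dbE : 'd (cst b : V -> 'rV_p) v = (0 : V -> 'rV_p) :> (V -> 'rV_p).
  exact: diff_cst.
have E : 'd (fun w : V => w *m J + b) v =
    'd (mulmxr J : V -> 'rV_p) v \+ 'd (cst b : V -> 'rV_p) v :> (V -> 'rV_p).
  exact: (diffD dJ db).
apply/row_matrixP => i; rewrite !rowE /jacobian mul_rV_lin1.
apply: etrans (congr1 (fun g => g (delta_mx 0 i)) E) _.
apply: etrans (congr2 +%R (congr1 (fun g => g (delta_mx 0 i)) dl)
  (congr1 (fun g => g (delta_mx 0 i)) dbE)) _.
exact: addr0.
Qed.

Lemma partialE_jacobian p (f : V -> 'rV[R]_p) i v : differentiable f v ->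
  partial i f v = row i ('J f v).
Proof. by move=> df; rewrite /partial deriveEjacobian // rowE. Qed.

Lemma partial_mx p q (M : V -> 'M[R]_(p, q)) i v :
    (forall j k, differentiable (fun w => M w j k) v) ->
  partial i M v = \matrix_(j, k) partial i (fun w => M w j k) v.
Proof.
move=> dM; apply: derive_mx; apply/derivable_mxP => j k.
exact: diff_derivable.
Qed.

Lemma differentiable_affine_coord p (J : 'M[R]_(n, p)) b k v :
  differentiable (fun w : V => (w *m J + b) 0 k) v.
Proof.
apply: (@differentiable_comp _ _ _ _ (fun w : V => w *m J + b) (fun w : 'rV_p => w 0 k)).
  exact: differentiable_affine.
exact: differentiable_coord.
Qed.

Lemma partial_affine p (J : 'M[R]_(n, p)) b k i v :
  partial i (fun w : V => (w *m J + b) 0 k) v = J i k.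
Proof.
have := partialE_jacobian i (differentiable_affine J b v).
rewrite jacobian_affine partial_mx.
  by move/matrixP/(_ 0 k); rewrite !mxE => ->.
by move=> j l; rewrite ord1; exact: differentiable_affine_coord.
Qed.

Lemma partial_proj k i v : partial i (fun w : V => w 0 k) v = (i == k)%:R.
Proof.
have -> : (fun w : V => w 0 k) = (fun w : V => (w *m 1%:M + 0) 0 k).
  by apply: funext => w; rewrite mulmx1 addr0.
by rewrite partial_affine mxE.
Qed.

Lemma smooth_on_affine (J : 'M[R]_n) b k :
  smooth_on A (fun w : V => (w *m J + b) 0 k).
Proof.
apply: (smooth_on_coind (P := fun f => f = (fun w : V => (w *m J + b) 0 k) \/
  exists k, f = fun=> k)); last by left.
  move=> f v [->|[c ->]] _; first exact: differentiable_affine_coord.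
  exact: differentiable_cst.
move=> f i [->|[c ->]]; last first.
  by exists (fun=> 0); [right; exists 0 | move=> v _; exact: partial_cst].
exists (fun=> J i k); first by right; exists (J i k).
by move=> v _; exact: partial_affine.
Qed.

Lemma differentiable_comp1 (f : V -> R) (g : R -> R) v :
  differentiable f v -> derivable g (f v) 1 -> differentiable (fun w => g (f w)) v.
Proof.
move=> df /derivable1_diffP dg; exact: (@differentiable_comp _ _ _ _ f g).
Qed.

Lemma partial_comp1 (f : V -> R) (g : R -> R) g' i v :
  differentiable f v -> is_derive (f v) 1 g g' ->
  partial i (fun w => g (f w)) v = g' * partial i f v.
Proof.
move=> df dg; have dg' : derivable g (f v) 1 by exact: ex_derive.
have dgd : differentiable g (f v) by apply/derivable1_diffP.
have dgf := differentiable_comp1 df dg'.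
have E : 'd (fun w => g (f w)) v = 'd g (f v) \o 'd f v :> (V -> R).
  exact: (diff_comp df dgd).
rewrite /partial !deriveE // E /= (diff1E dgd) derive1E derive_val.
exact: mulrC.
Qed.

Lemma differentiable_fsum (I : Type) (r : seq I) (F : I -> V -> R) v :
  (forall i, differentiable (F i) v) ->
  differentiable (fun w => \sum_(i <- r) F i w) v.
Proof.
move=> dF; elim: r => [|i r IHr].
  rewrite (_ : (fun w => _) = cst 0); first exact: differentiable_cst.
  by apply: funext => w; rewrite big_nil.
rewrite (_ : (fun w => _) = F i + (fun w => \sum_(j <- r) F j w)).
  exact: differentiableD.
by apply: funext => w; rewrite big_cons.
Qed.

Lemma partial_fsum (I : Type) (r : seq I) (F : I -> V -> R) k v :
  (forall i, differentiable (F i) v) ->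
  partial k (fun w => \sum_(i <- r) F i w) v = \sum_(i <- r) partial k (F i) v.
Proof.
move=> dF; elim: r => [|i r IHr].
  rewrite big_nil (_ : (fun w => _) = cst 0); first exact: partial_cst.
  by apply: funext => w; rewrite big_nil.
rewrite big_cons -IHr -partialD //; last exact: differentiable_fsum.
by congr partial; apply: funext => w; rewrite big_cons.
Qed.

End SmoothOn.
(** * The invariant metric and its Weyl connection *)

Section LogMonomials.
Variables (R : realType) (s t : nat).
Local Notation m := (s + t)%N.
Local Notation V := 'rV[R]_(m + m).
Local Notation HC := (@HsCt R s t).
Implicit Types (c d : 'cV[R]_s) (v w : V).

Definition yindex (i : 'I_s) : 'I_(m + m) := rshift m (lshift t i).

Definition logc c v : R := (logy v *m c) 0 0.

(* The monomial [\prod_i y_i ^ c_i] in the imaginary parts. *)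
Definition Emon c v : R := expR (logc c v).

(** The partial derivatives of [logc c], supported on the imaginary directions of the real
    places. *)
Definition dlogc c (k : 'I_(m + m)) v : R :=
  \sum_i c i 0 * ((k == yindex i)%:R / ypart i v).

Lemma logcE c v : logc c v = \sum_i c i 0 * ln (ypart i v).
Proof. by rewrite /logc mxE; apply: eq_bigr => i _; rewrite mxE mulrC. Qed.

Lemma logcD c d v : logc (c + d) v = logc c v + logc d v.
Proof. by rewrite /logc mulmxDr mxE. Qed.

Lemma EmonD c d v : Emon (c + d) v = Emon c v * Emon d v.
Proof. by rewrite /Emon logcD expRD. Qed.

Lemma Emon_gt0 c v : 0 < Emon c v.
Proof. exact: expR_gt0. Qed.

Lemma Emon0 v : Emon 0 v = 1.
Proof. by rewrite /Emon /logc mulmx0 mxE expR0. Qed.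

Lemma Emon_delta i v : HC v -> Emon (- delta_mx i 0) v = (ypart i v)^-1.
Proof.
move=> Hv; have y0 : 0 < ypart i v by exact: Hv.
rewrite /Emon logcE (bigD1 i) //= big1 ?addr0 => [|j /negPf ji]; last first.
  by rewrite !mxE ji oppr0 mul0r.
by rewrite !mxE !eqxx mulN1r expRN lnK // posrE.
Qed.

Lemma dlogcD c d k v : dlogc (c + d) k v = dlogc c k v + dlogc d k v.
Proof. by rewrite -big_split; apply: eq_bigr => i _; rewrite mxE mulrDl. Qed.

Lemma dlogcZ (r : R) c k v : dlogc (r *: c) k v = r * dlogc c k v.
Proof. by rewrite mulr_sumr; apply: eq_bigr => i _; rewrite mxE mulrA. Qed.

Lemma dlogcN c k v : dlogc (- c) k v = - dlogc c k v.
Proof. by rewrite -scaleN1r dlogcZ mulN1r. Qed.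

Lemma dlogcB c d k v : dlogc (c - d) k v = dlogc c k v - dlogc d k v.
Proof. by rewrite dlogcD dlogcN. Qed.

Lemma dlogc0 k v : dlogc 0 k v = 0.
Proof. by rewrite -(scale0r 0) dlogcZ mul0r. Qed.

Lemma yindex_inj : injective yindex.
Proof. by move=> i j /rshift_inj/lshift_inj. Qed.

Lemma cindex_yindex i : cindex (yindex i) = lshift t i.
Proof. exact: cindexr. Qed.

Lemma dlogc_yindex c i v : dlogc c (yindex i) v = c i 0 / ypart i v.
Proof.
rewrite /dlogc (bigD1 i) //= eqxx mul1r big1 ?addr0 // => j ji.
by rewrite (inj_eq yindex_inj) eq_sym (negPf ji) mul0r mulr0.
Qed.

Lemma dlogc_eq0 c k v : (forall i, k != yindex i) -> dlogc c k v = 0.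
Proof.
by move=> ky; apply: big1 => i _; rewrite (negPf (ky i)) mul0r mulr0.
Qed.

Lemma differentiable_ln_ypart i v : HC v ->
  differentiable (fun w => ln (ypart i w)) v.
Proof.
move=> Hv; apply: differentiable_comp1; first exact: differentiable_coord.
by apply: ex_derive; apply: is_derive1_ln; exact: Hv.
Qed.

Lemma partial_ln_ypart i k v : HC v ->
  partial k (fun w => ln (ypart i w)) v = (k == yindex i)%:R / ypart i v.
Proof.
move=> Hv; have dl := is_derive1_ln (Hv i).
rewrite (partial_comp1 k _ dl); last exact: differentiable_coord.
by rewrite partial_proj mulrC.
Qed.

Lemma differentiable_logc c v : HC v -> differentiable (logc c) v.
Proof.
move=> Hv; rewrite (_ : logc c = fun w => \sum_i c i 0 * ln (ypart i w)).
  by apply: differentiable_fsum => i; apply: differentiableZ;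
     exact: differentiable_ln_ypart.
by apply: funext => w; exact: logcE.
Qed.

Lemma partial_logc c k v : HC v -> partial k (logc c) v = dlogc c k v.
Proof.
move=> Hv; rewrite (_ : logc c = fun w => \sum_i c i 0 * ln (ypart i w)).
  rewrite partial_fsum => [|i].
    apply: eq_bigr => i _; rewrite partialZ ?partial_ln_ypart //.
    exact: differentiable_ln_ypart.
  by apply: differentiableZ; exact: differentiable_ln_ypart.
by apply: funext => w; exact: logcE.
Qed.

Lemma differentiable_Emon c v : HC v -> differentiable (Emon c) v.
Proof.
by move=> Hv; apply: differentiable_comp1; [exact: differentiable_logc|].
Qed.

Lemma partial_Emon c k v : HC v ->
  partial k (Emon c) v = dlogc c k v * Emon c v.
Proof.
move=> Hv; rewrite (partial_comp1 k (differentiable_logc c Hv) (is_derive_expR _)).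
by rewrite partial_logc // mulrC.
Qed.

(** Since 1 / y_i is itself a monomial, the derivatives of monomials are combinations of
    monomials. *)
Lemma dlogc_Emon c d k v : HC v -> dlogc c k v * Emon d v =
  \sum_i (c i 0 * (k == yindex i)%:R) * Emon (d - delta_mx i 0) v.
Proof.
move=> Hv; rewrite mulr_suml; apply: eq_bigr => i _.
by rewrite EmonD Emon_delta //; ring.
Qed.

(** The index type is existential in the coinductive class because differentiation replaces [I] by
    [I * 'I_s]. *)
Lemma smooth_on_Emon_sum (I : finType) (r : I -> R) (c : I -> 'cV[R]_s) :
  smooth_on HC (fun v => \sum_i r i * Emon (c i) v).
Proof.
apply: (smooth_on_coind (@HsCt_open R s t) (P := fun f => exists (I : finType)
  (r : I -> R) (c : I -> 'cV[R]_s), f = fun v => \sum_i r i * Emon (c i) v));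
  last by exists I, r, c.
  move=> _ v [{}I [{}r [{}c ->]]] Hv; apply: differentiable_fsum => i.
  by apply: differentiableZ; exact: differentiable_Emon.
move=> _ k [{}I [{}r [{}c ->]]].
exists (fun v => \sum_(p : I * 'I_s) (r p.1 * (c p.1 p.2 0 * (k == yindex p.2)%:R))
    * Emon (c p.1 - delta_mx p.2 0) v).
  exists (I * 'I_s)%type; eexists; exists (fun p => c p.1 - delta_mx p.2 0).
  reflexivity.
move=> v; rewrite inE => Hv; rewrite partial_fsum => [|i]; last first.
  by apply: differentiableZ; exact: differentiable_Emon.
rewrite -(pair_bigA _ (fun i j => r i * (c i j 0 * (k == yindex j)%:R)
    * Emon (c i - delta_mx j 0) v)) /=.
apply: eq_bigr => i _; rewrite partialZ; last exact: differentiable_Emon.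
rewrite partial_Emon // dlogc_Emon // mulr_sumr.
by apply: eq_bigr => j _; rewrite !mulrA.
Qed.

Lemma smooth_on_Emon c : smooth_on HC (Emon c).
Proof.
apply: (smooth_on_eq (@HsCt_open R s t)) (smooth_on_Emon_sum
  (fun _ : 'I_1 => 1) (fun=> c)).
by move=> v _; rewrite big_ord1 mul1r.
Qed.

Lemma smooth_on_dlogc_Emon c d k : smooth_on HC (fun v => dlogc c k v * Emon d v).
Proof.
apply: (smooth_on_eq (@HsCt_open R s t)) (smooth_on_Emon_sum
  (fun i => c i 0 * (k == yindex i)%:R) (fun i => d - delta_mx i 0)).
by move=> v; rewrite inE => Hv; rewrite dlogc_Emon.
Qed.

Lemma smooth_on_dlogc c k : smooth_on HC (dlogc c k).
Proof.
apply: (smooth_on_eq (@HsCt_open R s t)) (smooth_on_dlogc_Emon c 0 k).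
by move=> v _; rewrite Emon0 mulr1.
Qed.

(** Symmetry of the second derivatives of [logc c], read off an explicit formula; it gives the
    closedness of the Lee form. *)
Lemma partial_dlogc_sym c i j v : HC v ->
  partial i (dlogc c j) v = partial j (dlogc c i) v.
Proof.
move=> Hv; suff E k l : partial k (dlogc c l) v =
    \sum_p c p 0 * (l == yindex p)%:R * (k == yindex p)%:R * - (ypart p v)^-1 ^+ 2.
  by rewrite !E; apply: eq_bigr => p _; ring.
have lE : {in HC, dlogc c l =1
    fun w => \sum_p (c p 0 * (l == yindex p)%:R) * Emon (- delta_mx p 0) w}.
  by move=> w; rewrite inE => Hw; apply: eq_bigr => p _; rewrite Emon_delta //; ring.
rewrite (partial_eq_on (@HsCt_open R s t) k Hv lE) partial_fsum => [|p]; last first.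
  by apply: differentiableZ; exact: differentiable_Emon.
apply: eq_bigr => p _; rewrite partialZ; last exact: differentiable_Emon.
rewrite partial_Emon // Emon_delta // dlogcN /dlogc (bigD1 p) //= big1 => [|q].
  by rewrite !mxE !eqxx /= expr2 addr0 mul1r; ring.
by move=> /negPf qp; rewrite !mxE qp mul0r.
Qed.

End LogMonomials.

(** * Absolute values of units as exponentials of linear forms *)

Section Exponents.
Variables (R : realType) (K : fieldExtType rat) (s t : nat).
Hypothesis s_gt0 : (0 < s)%N.
Variable sigma : 'I_(s + t + t) -> {rmorphism K -> R[i]}.
Hypothesis Hsigma : lists_embeddings sigma.
Variable U : set K.
Hypothesis HU : admissible sigma U.

Local Notation m := (s + t)%N.
Local Notation sg i := (sigma (lshift t i)).

Let U1 : U 1. Proof. by case: HU. Qed.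
Let UM u u' : U u -> U u' -> U (u * u'). Proof. by case: HU => _ _ + _ _; apply. Qed.
Let UV u : U u -> U u^-1. Proof. by case: HU => _ _ _ + _; apply. Qed.
Let UL : full_lattice [set lsubmx (ell sigma u) | u in U]. Proof. by case: HU. Qed.

(* [ln |sigma_i|] is additive on the lattice of [U] in [R^s], hence is the
   restriction of the linear form [b i]. *)
Lemma cabs_exponents : exists b : 'I_m -> 'cV[R]_s,
  (forall i, b (lshift t i) = delta_mx i 0) /\
  (forall u i, U u -> cabs (sg i u) = expR ((Ulog sigma u *m b i) 0 0)).
Proof.
have lin i : exists c : 'cV[R]_s, forall u, U u ->
    ln (cabs (sg i u)) = (Ulog sigma u *m c) 0 0.
  (* The unit with a given logarithm is unique by [Ulog_inj]; the default 1 is taken only off the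
     lattice. *)
  pose inv (l : 'rV[R]_s) := xget 1 [set u | U u /\ Ulog sigma u = l].
  have invK u : U u -> inv (Ulog sigma u) = u.
    move=> Uu.
    have [Uv uv] : U (inv (Ulog sigma u)) /\
        Ulog sigma (inv (Ulog sigma u)) = Ulog sigma u.
      by apply: (@xgetPex _ 1 [set v | U v /\ Ulog sigma v = Ulog sigma u]); exists u.
    exact: (Ulog_inj s_gt0 Hsigma HU).
  have [|c Hc] := lattice_linear_ext UL (f := fun l => ln (cabs (sg i (inv l)))).
    move=> _ _ [u Uu <-] [v Uv <-]; rewrite -!/(Ulog _ _).
    have -> : Ulog sigma u - Ulog sigma v = Ulog sigma (u / v).
      by rewrite (UlogM HU) ?(UlogV HU) //; exact: UV.
    rewrite !invK //; last by apply: UM => //; exact: UV.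
    rewrite rmorphM cabsM fmorphV cabsV lnM ?posrE ?invr_gt0 ?(cabs_U_gt0 HU) //.
    by rewrite lnV // posrE (cabs_U_gt0 HU).
  exists c => u Uu; rewrite -{1}(invK u Uu); apply: Hc.
  by exists u.
have /choice[b Hb] := lin.
(* At a real place the coordinate form is taken, as [Ulog] consists of these very logarithms. *)
exists (fun i => if fintype.split i is inl j then delta_mx j 0 else b i).
split=> [i|u i Uu]; first by rewrite (unsplitK (inl _)).
have cgt0 := cabs_U_gt0 HU i Uu.
rewrite -[LHS](lnK _) ?posrE //; congr expR.
move: cgt0 => _; rewrite -(splitK i); case: (fintype.split i) => j /=.
  by rewrite (unsplitK (inl _)) -UlogE -colE [in RHS]mxE.
by rewrite Hb // -[rshift s j]/(unsplit (inr j)) unsplitK.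
Qed.

(** The relation holds on the lattice by the product formula for units, and a linear form vanishing
    on a full lattice is zero. *)
Lemma sum_exponents (b : 'I_m -> 'cV[R]_s) :
    (forall u i, U u -> cabs (sg i u) = expR ((Ulog sigma u *m b i) 0 0)) ->
  \sum_i b (lshift t i) + 2 *: \sum_j b (rshift s j) = 0.
Proof.
move=> Hb; apply: (lattice_span UL) => _ [u Uu <-].
have pu : positive_unit sigma u by case: HU => + _ _ _ _; apply.
apply/matrixP => i j; rewrite !ord1 mulmxDr -scalemxAr !mulmx_sumr.
rewrite !mxE !summxE -[RHS](sum_ln_cabs_unit Hsigma pu).
by congr (_ + 2 * _); apply: eq_bigr => k _; rewrite Hb // expRK.
Qed.

(** The real places contribute 1 to coordinate [p] of [sum_exponents], so the complex ones must
    contribute -1. *)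
Lemma negative_exponent (b : 'I_m -> 'cV[R]_s) :
    (forall i, b (lshift t i) = delta_mx i 0) ->
    (forall u i, U u -> cabs (sg i u) = expR ((Ulog sigma u *m b i) 0 0)) ->
  exists j p, b (rshift s j) p 0 < 0.
Proof.
move=> b_real Hb; pose p := Ordinal s_gt0.
have [//|none] := pselect (exists j p, b (rshift s j) p 0 < 0).
have /matrixP/(_ p 0) := sum_exponents Hb.
rewrite !mxE !summxE (bigD1 p) //= b_real mxE !eqxx big1 => [|i /negPf ip].
  have ge0 j : 0 <= b (rshift s j) p 0.
    by rewrite leNgt; apply/negP => lt0; apply: none; exists j, p.
  have : 0 <= \sum_j b (rshift s j) p 0 by apply: sumr_ge0.
  rewrite /= mulr1n; lra.
by rewrite b_real mxE eq_sym ip.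
Qed.

End Exponents.
(** Transposition is conjugation, so the row relations of [multmx_mul_tr] also yield column
    relations. *)
Lemma multmx_tr (R : realType) (s t : nat) (f : 'I_(s + t) -> R[i]) :
  (multmx f)^T = multmx (fun i => (f i)^*).
Proof.
rewrite /multmx tr_block_mx linearN /= !tr_diag_mx; congr block_mx.
- by congr diag_mx; apply/rowP => i; rewrite !mxE; case: (f i).
- by rewrite -linearN; congr diag_mx; apply/rowP => i; rewrite !mxE; case: (f i).
- rewrite -linearN; congr diag_mx; apply/rowP => i; rewrite !mxE.
  by case: (f i) => x y /=; rewrite opprK.
- by congr diag_mx; apply/rowP => i; rewrite !mxE; case: (f i).
Qed.

(** * Invariance of the metric, the Lee form and the connection *)

Section InvariantTensors.
Variables (R : realType) (K : fieldExtType rat) (s t : nat).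
Hypothesis s_gt0 : (0 < s)%N.
Variable sigma : 'I_(s + t + t) -> {rmorphism K -> R[i]}.
Hypothesis Hsigma : lists_embeddings sigma.
Variable U : set K.
Hypothesis HU : admissible sigma U.

Local Notation m := (s + t)%N.
Local Notation V := 'rV[R]_(m + m).
Local Notation sg i := (sigma (lshift t i)).
Local Notation HC := (@HsCt R s t).
Local Notation act := (act sigma).
Local Notation J u := (multmx (fun i => sg i u)).
Implicit Types (u al : K) (v w : V) (c : 'cV[R]_s).

Variables (b : 'I_m -> 'cV[R]_s) (a : 'cV[R]_s).
Hypothesis b_real : forall i : 'I_s, b (lshift t i) = delta_mx i 0.
Hypothesis Hb : forall u (i : 'I_m), U u -> cabs (sg i u) = expR ((Ulog sigma u *m b i) 0 0).

Local Notation bc k := (b (cindex k)).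

Lemma J_yindex u i p : U u ->
  J u i (yindex t p) = (i == yindex t p)%:R * cabs (sg (lshift t p) u).
Proof.
move=> Uu; have pu : positive_unit sigma u by case: HU => + _ _ _ _; apply.
have E := positive_unit_cabs Hsigma p pu.
rewrite -(splitK i); case: (fintype.split i) => q /=; rewrite /yindex.
  rewrite block_mxEur !mxE eq_lrshift mul0r; have [->|_] := eqVneq q; last by rewrite mulr0n.
  by rewrite E mulr1n.
rewrite block_mxEdr !mxE (inj_eq (@rshift_inj _ _)).
by have [->|_] := eqVneq q; rewrite ?mulr0n ?mul0r // [in LHS]E mulr1n mul1r.
Qed.

(** [logc c] changes by an additive constant under the action, so its differential is invariant;
    this is checked on the formula. *)
Lemma dlogc_act u al c i v : U u -> HC v ->
  \sum_k J u i k * dlogc c k (act u al v) = dlogc c i v.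
Proof.
move=> Uu Hv; rewrite /dlogc; under eq_bigr do rewrite mulr_sumr.
rewrite exchange_big; apply: eq_bigr => p _ /=.
rewrite (bigD1 (yindex t p)) //= big1 ?addr0 => [|k /negPf kp]; last first.
  by rewrite kp mul0r !mulr0.
rewrite J_yindex // eqxx (ypart_act Hsigma HU) // invfM.
have c0 : cabs (sg (lshift t p) u) != 0 by rewrite gt_eqF // (cabs_U_gt0 HU).
have y0 : ypart p v != 0 by rewrite gt_eqF //; exact: Hv.
by case: (i == _); rewrite /= ?mul0r ?mulr0 //; field; rewrite c0 y0.
Qed.

Lemma Emon_act u al c v : U u -> HC v ->
  Emon c (act u al v) = expR ((Ulog sigma u *m c) 0 0) * Emon c v.
Proof.
by move=> Uu Hv; rewrite /Emon /logc (logy_act Hsigma HU) // mulmxDl mxE expRD.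
Qed.

(** [J u] preserves each complex coordinate line, so factors depending only on the complex index
    pass through it. *)
Lemma J_cindex u i k (F : 'I_m -> R) :
  J u i k * F (cindex k) = J u i k * F (cindex i).
Proof.
have [->//|ik] := eqVneq (cindex i) (cindex k).
by rewrite (multmx_eq0 _ ik) !mul0r.
Qed.

Lemma J_rows u i j :
  \sum_k J u i k * J u j k = (i == j)%:R * cabs (sg (cindex i) u) ^+ 2.
Proof.
have /matrixP/(_ i j) := multmx_mul_tr (fun i => sg i u).
rewrite mxE; under eq_bigr do rewrite [X in _ * X]mxE.
by move=> ->; rewrite !mxE mulr_natl.
Qed.

Lemma J_cols u i j :
  \sum_k J u k i * J u k j = (i == j)%:R * cabs (sg (cindex i) u) ^+ 2.
Proof.
have /matrixP/(_ i j) := multmx_mul_tr (fun i => (sg i u)^*).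
rewrite -multmx_tr trmxK mxE; under eq_bigr do rewrite [X in X * _]mxE.
by move=> ->; rewrite !mxE cabs_conj mulr_natl.
Qed.

(* [b n] is the logarithmic weight of [|sigma_n|]. When [a = b (s + j0)] and
   [f = logc a], the coordinate [z_(s+j0)] is a flat factor of the metric
   [exp (2 f) ot_metric]. *)
Definition ot_metric v : 'M[R]_(m + m) :=
  diag_mx (\row_k Emon (- (2 *: bc k)) v).

(** For a diagonal metric with entries exp (2 psi_k), Gamma_ij^l is d_i psi_j if j = l, plus d_j
    psi_i if i = l, minus d_l psi_i exp (2 (psi_i - psi_l)) if i = j. Here psi_k = logc (a -
    b_k). *)
Definition ot_christoffel v i : 'M[R]_(m + m) := \matrix_(j, l)
  (dlogc (a - bc j) i v * (j == l)%:R + dlogc (a - bc i) j v * (i == l)%:R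
   - dlogc (a - bc i) l v * Emon (2 *: (bc l - bc i)) v * (i == j)%:R).

Definition ot_lee v : 'cV[R]_(m + m) := \col_i dlogc a i v.

(** The rows of [J u] are orthogonal with squared length |sigma_n u|^2, which cancels the factor
    gained by the monomial of exponent -2 b_n. *)
Lemma ot_metric_act u al v : U u -> HC v ->
  ot_metric v = J u *m ot_metric (act u al v) *m (J u)^T.
Proof.
move=> Uu Hv; apply/matrixP => i j.
transitivity (\sum_k J u i k * Emon (- (2 *: bc k)) (act u al v) * J u j k); last first.
  rewrite [RHS]mxE; apply: eq_bigr => k _; rewrite [X in _ = _ * X]mxE; congr (_ * _).
  by rewrite /ot_metric mul_mx_diag [RHS]mxE; congr (_ * _); rewrite mxE.
transitivity (\sum_k J u i k * J u j k * Emon (- (2 *: bc i)) (act u al v)).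
  rewrite -mulr_suml J_rows Emon_act // /ot_metric mxE mxE -mulr_natl.
  case: (i == j); rewrite /= ?mul0r // !mul1r.
  rewrite mulrA Hb // -expRM_natl -expRD mulmxN -scalemxAr !mxE.
  by rewrite mulr_natl subrr expR0 mul1r.
apply: eq_bigr => k _; rewrite mulrAC; congr (_ * _).
exact/esym/(J_cindex u i k (fun n => Emon (- (2 *: b n)) (act u al v))).
Qed.

Lemma ot_lee_act u al v : U u -> HC v -> ot_lee v = J u *m ot_lee (act u al v).
Proof.
move=> Uu Hv; apply/matrixP => i j.
rewrite [LHS]mxE [RHS]mxE -(dlogc_act al a i Uu Hv).
by apply: eq_bigr => k _; congr (_ * _); rewrite mxE.
Qed.

(** The law is homogeneous because [J u] is independent of the point. The first two terms follow
    from [dlogc_act] and [J_cindex]; the third needs the orthogonality of rows and columns to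
    balance the change of [Emon]. *)
Lemma ot_christoffel_act u al v i : U u -> HC v ->
  ot_christoffel v i *m J u =
  J u *m \sum_k (J u i k *: ot_christoffel (act u al v) k).
Proof.
move=> Uu Hv; set v' := act u al v.
have dE c k := dlogc_act al c k Uu Hv.
pose e n := cabs (sg n u) ^+ 2.
have e0 n : e n != 0 by rewrite expf_neq0 // gt_eqF // (cabs_U_gt0 HU).
have EE n n' : Emon (2 *: (b n - b n')) v' = e n / e n' * Emon (2 *: (b n - b n')) v.
  rewrite Emon_act // /e !Hb // -!expRM_natl -expRB; congr (expR _ * _).
  by rewrite -scalemxAr mulmxBr !mxE !mulr_natl; ring.
apply/matrixP => j l; rewrite [LHS]mxE [RHS]mxE.
under [LHS]eq_bigr do rewrite [X in X * _]mxE.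
transitivity (dlogc (a - bc j) i v * J u j l + dlogc (a - bc i) j v * J u i l
  - (i == j)%:R * (Emon (2 *: (bc l - bc i)) v * (e (cindex l) * dlogc (a - bc i) l v'))).
  under eq_bigr do rewrite mulrBl mulrDl.
  rewrite big_split sumrN big_split /=; congr (_ + _ - _).
  - by rewrite (bigD1 j) //= big1 ?eqxx ?mulr1 ?addr0 // => k;
       rewrite eq_sym => /negPf ->; rewrite mulr0 mul0r.
  - by rewrite (bigD1 i) //= big1 ?eqxx ?mulr1 ?addr0 // => k;
       rewrite eq_sym => /negPf ->; rewrite mulr0 mul0r.
  transitivity ((i == j)%:R * (Emon (2 *: (bc l - bc i)) v *
     \sum_k J u k l * dlogc (a - bc i) k v)).
    rewrite mulrA !mulr_sumr; apply: eq_bigr => k _.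
    have := J_cindex u k l (fun n => Emon (2 *: (b n - bc i)) v) => Ekl.
    transitivity ((i == j)%:R * dlogc (a - bc i) k v *
      (J u k l * Emon (2 *: (b (cindex k) - bc i)) v)); first by ring.
    by rewrite -Ekl; ring.
  congr (_ * (_ * _)).
  under eq_bigr do rewrite -dE mulr_sumr.
  rewrite exchange_big /=.
  (* Column orthogonality leaves only the index [l], with factor [e] there. *)
  transitivity (\sum_k (\sum_n J u n l * J u n k) * dlogc (a - bc i) k v').
    by apply: eq_bigr => k _; rewrite mulr_suml; apply: eq_bigr => n _; rewrite mulrA.
  rewrite (bigD1 l) //= [X in _ + X]big1 => [|k kl]; first by rewrite addr0 J_cols eqxx mul1r.
  by rewrite J_cols eq_sym (negPf kl) !mul0r.
transitivity (\sum_k \sum_n J u j k * (J u i n * ot_christoffel v' n k l)); last first.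
  apply: eq_bigr => k _; rewrite summxE mulr_sumr.
  by apply: eq_bigr => n _; congr (_ * _); rewrite [RHS]mxE.
transitivity (\sum_k \sum_n (J u j k * (k == l)%:R * (J u i n * dlogc (a - bc l) n v')
   + J u i n * (n == l)%:R * (J u j k * dlogc (a - bc l) k v')
   - J u j k * J u i n * (n == k)%:R *
      (dlogc (a - bc i) l v' * Emon (2 *: (bc l - bc i)) v'))); last first.
  apply: eq_bigr => k _; apply: eq_bigr => n _.
  rewrite [X in _ = _ * (_ * X)]mxE.
  have E1 : (k == l)%:R * dlogc (a - bc k) n v' = (k == l)%:R * dlogc (a - bc l) n v'.
    by case: eqVneq => [->//|_]; rewrite !mul0r.
  have E2 : (n == l)%:R * dlogc (a - bc n) k v' = (n == l)%:R * dlogc (a - bc l) k v'.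
    by case: eqVneq => [->//|_]; rewrite !mul0r.
  have E3 := J_cindex u i n (fun q => dlogc (a - b q) l v' * Emon (2 *: (bc l - b q)) v').
  rewrite /= in E3.
  transitivity (J u j k * J u i n * ((k == l)%:R * dlogc (a - bc l) n v')
    + J u j k * J u i n * ((n == l)%:R * dlogc (a - bc l) k v')
    - J u j k * (n == k)%:R * (J u i n *
      (dlogc (a - bc i) l v' * Emon (2 *: (bc l - bc i)) v'))); first by ring.
  by rewrite -E1 -E2 -E3; ring.
under eq_bigr do rewrite sumrB big_split /=.
rewrite sumrB big_split /=; congr (_ + _ - _).
- rewrite (bigD1 l) //= [X in (_ = _ + X)]big1 ?addr0 => [|k /negPf ->]; last first.
    by apply: big1 => n _; rewrite mulr0 mul0r.
  rewrite -mulr_sumr dE eqxx mulr1 mulrC.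
  exact/esym/(J_cindex u j l (fun q => dlogc (a - b q) i v)).
- rewrite exchange_big (bigD1 l) //= [X in (_ = _ + X)]big1 ?addr0 => [|k /negPf ->]; last first.
    by apply: big1 => n _; rewrite mulr0 mul0r.
  rewrite -mulr_sumr dE eqxx mulr1 mulrC.
  exact/esym/(J_cindex u i l (fun q => dlogc (a - b q) j v)).
(* Row orthogonality gives the factor [e] at [i], and the monomial changes by the ratio of [e] at
   [l] to [e] at [i]. *)
transitivity ((\sum_k J u j k * J u i k) *
   (dlogc (a - bc i) l v' * Emon (2 *: (bc l - bc i)) v')).
  rewrite J_rows EE eq_sym; have [->|_] := eqVneq i j; last by rewrite !mul0r.
  rewrite -/(e _); field; exact: e0.
rewrite mulr_suml; apply: eq_bigr => k _; rewrite (bigD1 k) //= big1 ?addr0.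
  by rewrite eqxx mulr1.
by move=> n /negPf ->; rewrite mulr0 mul0r.
Qed.

End InvariantTensors.

(** * Smoothness, Weyl equation and curvature on the cover *)

Section LocalGeometry.
Variables (R : realType) (s t : nat).
Local Notation m := (s + t)%N.
Local Notation V := 'rV[R]_(m + m).
Local Notation HC := (@HsCt R s t).
Implicit Types (v w : V) (c : 'cV[R]_s).

Variables (b : 'I_m -> 'cV[R]_s) (a : 'cV[R]_s).
Hypothesis b_real : forall i : 'I_s, b (lshift t i) = delta_mx i 0.

Local Notation bc k := (b (cindex k)).
Local Notation g := (ot_metric b).
Local Notation Gam := (ot_christoffel b a).
Local Notation theta := (ot_lee a).
Let oH : open HC := @HsCt_open R s t.

Lemma smooth_on_ot_metric j l : smooth_on HC (fun v => g v j l).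
Proof.
apply: (smooth_on_eq oH) (smooth_onZ oH (j == l)%:R (smooth_on_Emon (- (2 *: bc j)))).
by move=> v _; rewrite !mxE mulr_natl.
Qed.

Lemma smooth_on_ot_christoffel i j l : smooth_on HC (fun v => Gam v i j l).
Proof.
pose F v := (j == l)%:R * dlogc (a - bc j) i v + (i == l)%:R * dlogc (a - bc i) j v
  - (i == j)%:R * (dlogc (a - bc i) l v * Emon (2 *: (bc l - bc i)) v).
apply: (smooth_on_eq oH (f := F)); first by move=> v _; rewrite /F !mxE; ring.
apply: smooth_onB => //; last by apply: smooth_onZ => //; exact: smooth_on_dlogc_Emon.
by apply: smooth_on_lincomb => //; exact: smooth_on_dlogc.
Qed.

Lemma smooth_on_ot_lee i : smooth_on HC (fun v => theta v i 0).
Proof. by apply: (smooth_on_eq oH) (smooth_on_dlogc a i) => v _; rewrite mxE. Qed.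

Lemma partial_ot_metric i v : HC v ->
  partial i g v = diag_mx (\row_j (- (2 * dlogc (bc j) i v) * Emon (- (2 *: bc j)) v)).
Proof.
move=> Hv; rewrite partial_mx => [|j l]; last first.
  exact: (smooth_on_differentiable (smooth_on_ot_metric j l)).
apply/matrixP => j l; rewrite !mxE.
have -> : (fun w => g w j l) = fun w => (j == l)%:R * Emon (- (2 *: bc j)) w.
  by apply: funext => w; rewrite !mxE mulr_natl.
rewrite partialZ ?partial_Emon // ?dlogcN ?dlogcZ ?mulr_natl //.
exact: differentiable_Emon.
Qed.

(* [ot_christoffel] is the Levi-Civita connection of [exp (2 * logc a) ot_metric]. *)
Lemma ot_lee_identity i v : HC v ->
  partial i g v - Gam v i *m g v - g v *m (Gam v i)^T = - (2 * theta v i 0) *: g v.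
Proof.
move=> Hv; rewrite partial_ot_metric //; apply/matrixP => j l.
rewrite /ot_metric mul_mx_diag mul_diag_mx !mxE.
have EE k n : Emon (2 *: (bc k - bc n)) v * Emon (- (2 *: bc k)) v = Emon (- (2 *: bc n)) v.
  by rewrite -EmonD scalerBr addrAC subrr sub0r.
pose G k := Emon (- (2 *: bc k)) v.
transitivity (- (2 * dlogc (bc j) i v) * G j *+ (j == l)
  - (dlogc (a - bc j) i v * (j == l)%:R * G l + dlogc (a - bc i) j v * (i == l)%:R * G l
     - dlogc (a - bc i) l v * (i == j)%:R * (Emon (2 *: (bc l - bc i)) v * G l))
  - (dlogc (a - bc l) i v * (l == j)%:R * G j + dlogc (a - bc i) l v * (i == j)%:R * G j
     - dlogc (a - bc i) j v * (i == l)%:R * (Emon (2 *: (bc j - bc i)) v * G j))).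
  by rewrite /G; ring.
(* Lowering the index turns the last term of each product into the middle term of the other; they
   cancel and only the diagonal remains. *)
have -> : dlogc (a - bc i) j v * (i == l)%:R * (Emon (2 *: (bc j - bc i)) v * G j)
    = dlogc (a - bc i) j v * (i == l)%:R * G l.
  by rewrite /G EE; case: eqVneq => [->//|_]; rewrite !(mulr0, mul0r).
have -> : dlogc (a - bc i) l v * (i == j)%:R * (Emon (2 *: (bc l - bc i)) v * G l)
    = dlogc (a - bc i) l v * (i == j)%:R * G j.
  by rewrite /G EE; case: eqVneq => [->//|_]; rewrite !(mulr0, mul0r).
have [->|_] := eqVneq j l; last by rewrite !mulr0n; ring.
by rewrite !mulr1n !dlogcB /G; ring.
Qed.

Lemma ot_christoffel_sym v i j k : Gam v i j k = Gam v j i k.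
Proof.
rewrite !mxE (eq_sym j i); have [->|_] := eqVneq i j; [by []|]; rewrite !mulr0; ring.
Qed.

(** The weight [a - b] is zero at this coordinate, and no [dlogc] has a component along it: this is
    the flat factor. *)
Lemma ot_christoffel_col0 v i j l (j0 : 'I_t) :
  a = b (rshift s j0) -> cindex l = rshift s j0 -> Gam v i j l = 0.
Proof.
move=> aE lE; rewrite mxE.
have dl0 c : dlogc c l v = 0.
  apply: dlogc_eq0 => p; apply/eqP => lp; move: lE; rewrite lp cindex_yindex.
  by move/eqP; rewrite eq_lrshift.
rewrite dl0 mul0r mul0r subr0.
have [->|_] := eqVneq j l.
  rewrite lE -aE subrr dlogc0 mul0r add0r; have [->|_] := eqVneq i l.
    by rewrite lE -aE subrr dlogc0 mul0r.
  by rewrite mulr0.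
rewrite mulr0 add0r; have [->|_] := eqVneq i l; last by rewrite mulr0.
by rewrite lE -aE subrr dlogc0 mul0r.
Qed.

Lemma logy_pt : logy (HsCt_pt R s t) = 0.
Proof. by apply/rowP => i; rewrite !mxE /ypart /zcoord /= mxE ln1. Qed.

Lemma Emon_pt c : Emon c (HsCt_pt R s t) = 1.
Proof. by rewrite /Emon /logc logy_pt mul0mx mxE expR0. Qed.

Lemma ypart_pt i : ypart i (HsCt_pt R s t) = 1.
Proof. by rewrite /ypart /zcoord /= mxE. Qed.

Definition xindex (i : 'I_s) : 'I_(m + m) := lshift m (lshift t i).

(* The entry is [\sum_(r != p) a_r ^ 2 + 1 - a_p]. *)
Lemma ot_curvature_pt p x y v : a p 0 < 0 ->
    x = xindex p -> y = yindex t p -> v = HsCt_pt R s t ->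
  (partial x (fun w => Gam w y) v - partial y (fun w => Gam w x) v
   + Gam v y *m Gam v x - Gam v x *m Gam v y) x y != 0.
Proof.
move=> ap0 xE yE vE; have Hv : HC v by rewrite vE; exact: HsCt_ptP.
(* The common weight of x_p and y_p, because b_p = e_p. *)
pose phi : 'cV[R]_s := a - delta_mx p 0.
have cx : bc x = delta_mx p 0 by rewrite xE /xindex cindexl b_real.
have cy : bc y = delta_mx p 0 by rewrite yE cindex_yindex b_real.
have xy : (x == y) = false by rewrite xE yE /xindex /yindex eq_lrshift.
have dx c w : dlogc c x w = 0.
  by apply: dlogc_eq0 => q; rewrite xE /xindex /yindex eq_lrshift.
have dG i j l : differentiable (fun w => Gam w i j l) v.
  exact: (smooth_on_differentiable (smooth_on_ot_christoffel i j l)).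
have yx : (y == x) = false by rewrite eq_sym.
have P1 : partial x (fun w => Gam w y) v x y = 0.
  rewrite partial_mx // mxE.
  have -> : (fun w => Gam w y x y) = fun=> 0.
    by apply: funext => w; rewrite mxE xy yx eqxx dx !mulr0 !mul0r !addr0 subr0.
  exact: partial_cst.
have Gxxy w : Gam w x x y = - dlogc phi y w.
  by rewrite mxE xy eqxx cx cy subrr scaler0 Emon0 -/phi /= !mulr0 !mulr1 ?addr0 sub0r.
have P2 : partial y (fun w => Gam w x) v x y = phi p 0.
  have dd : (delta_mx p 0 : 'cV[R]_s) p 0 = 1 by rewrite mxE !eqxx.
  rewrite partial_mx // mxE.
  have lE : {in HC, (fun w => Gam w x x y) =1 fun w => - phi p 0 * Emon (- delta_mx p 0) w}.
    by move=> w; rewrite inE => Hw; rewrite Gxxy yE dlogc_yindex Emon_delta // mulNr.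
  rewrite (partial_eq_on oH y Hv lE) partialZ; last exact: differentiable_Emon.
  rewrite partial_Emon // vE Emon_pt dlogcN yE dlogc_yindex ypart_pt dd.
  by field.
have Ev c : Emon c v = 1 by rewrite vE Emon_pt.
have dy : dlogc phi y v = phi p 0 by rewrite vE yE dlogc_yindex ypart_pt divr1.
have P3 : (Gam v y *m Gam v x) x y = - phi p 0 ^+ 2.
  rewrite mxE (bigD1 x) //= big1 ?addr0 => [|k /negPf kx].
    by rewrite Gxxy mxE eqxx dx cx -/phi yx dy /= !mulr0 !mulr1; ring.
  by rewrite [X in X * _]mxE (eq_sym x) kx yx dx /= !mulr0; ring.
have P4 : (Gam v x *m Gam v y) x y = - \sum_r phi r 0 ^+ 2.
  rewrite mxE -sumrN.
  transitivity (\sum_k - dlogc phi k v ^+ 2).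
    apply: eq_bigr => k _; rewrite [X in X * _]mxE [X in _ * X]mxE !eqxx dx cx cy -/phi.
    rewrite !Ev (eq_sym y k); have [->|ky] := eqVneq k y.
      rewrite ?cy -/phi /= ?mulr1 ?mulr0; case: (x == y); rewrite ?dx /= ?mul0r ?mulr1; ring.
    by case: (eqVneq x k) => [<-|_]; rewrite ?dx /= ?mulr0; ring.
  rewrite big_split_ord /= [X in X + _]big1 ?add0r; last first.
    by move=> k _; rewrite dlogc_eq0 ?expr0n ?oppr0 // => q; rewrite /yindex eq_lrshift.
  rewrite big_split_ord /= [X in _ + X]big1 ?addr0; last first.
    move=> k _; rewrite dlogc_eq0 ?expr0n ?oppr0 // => q.
    by rewrite /yindex (inj_eq (@rshift_inj _ _)) eq_rlshift.
  by apply: eq_bigr => r _; rewrite -/(yindex t r) vE dlogc_yindex ypart_pt divr1.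
have mx4 (A B C D : 'M[R]_(m + m)) :
  (A - B + C - D) x y = A x y - B x y + C x y - D x y by rewrite !mxE.
apply/eqP => H; have := etrans (esym (mx4 _ _ _ _)) H.
(* The terms add up to - phi_p + sum_(r <> p) phi_r^2, and phi_p = a_p - 1 is negative. *)
rewrite P1 P2 P3 P4 opprK (bigD1 p) //=.
have : 0 <= \sum_(i | i != p) phi i 0 ^+ 2 by apply: sumr_ge0 => i _; exact: sqr_ge0.
have -> : phi p 0 = a p 0 - 1 by rewrite !mxE !eqxx.
lra.
Qed.

End LocalGeometry.

(** * Chain rule, conformal rescaling and the mean value theorem *)

Section DifferentialCalculus.
Variables (R : realType) (n : nat).
Local Notation V := 'rV[R]_n.

Lemma partialM (f g : V -> R) i v : differentiable f v -> differentiable g v ->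
  partial i (fun w => f w * g w) v = f v * partial i g v + g v * partial i f v.
Proof. by move=> df dg; apply: deriveM; exact: diff_derivable. Qed.

Lemma diff_partial (f : V -> R) v y : differentiable f v ->
  'd f v y = \sum_k y 0 k * partial k f v.
Proof.
move=> df; rewrite {1}[y]row_sum_delta linear_sum; apply: eq_bigr => k _.
by rewrite linearZ /= /partial deriveE.
Qed.

Lemma partial_comp_affine (J : 'M[R]_n) b (f : V -> R) i v :
  differentiable f (v *m J + b) ->
  partial i (fun w => f (w *m J + b)) v
  = \sum_k J i k * partial k f (v *m J + b).
Proof.
move=> df; have dh := differentiable_affine J b v.
have dfh : differentiable (fun w => f (w *m J + b)) v.
  exact: (@differentiable_comp _ _ _ _ (fun w : V => w *m J + b) f).
have E : 'd (fun w => f (w *m J + b)) v =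
    'd f (v *m J + b) \o 'd (fun w : V => w *m J + b) v :> (V -> R).
  exact: (diff_comp dh df).
rewrite /partial deriveE // E /=.
have -> : 'd (fun w : V => w *m J + b) v (delta_mx 0 i) = row i J.
  rewrite -deriveE // -/(partial i (fun w : V => w *m J + b) v).
  by rewrite partialE_jacobian // jacobian_affine.
by rewrite diff_partial //; apply: eq_bigr => k _; rewrite mxE.
Qed.

Lemma partial_conformal p q (f : V -> R) (G : V -> 'M[R]_(p, q)) i v :
    differentiable f v -> (forall j k, differentiable (fun w => G w j k) v) ->
  partial i (fun w => expR (2 * f w) *: G w) v
  = expR (2 * f v) *: ((2 * partial i f v) *: G v + partial i G v).
Proof.
move=> df dG; have d2f : differentiable (fun w => 2 * f w) v by exact: differentiableZ.
have dE : differentiable (fun w => expR (2 * f w)) v.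
  by apply: differentiable_comp1 d2f _; exact: derivable_expR.
have entry j k : (fun w => (expR (2 * f w) *: G w) j k)
    = fun w => expR (2 * f w) * G w j k.
  by apply: funext => w; rewrite mxE.
rewrite [LHS]partial_mx => [|j k]; last by rewrite entry; exact: differentiableM.
rewrite [in RHS]partial_mx //; apply/matrixP => j k.
rewrite !mxE entry partialM // (partial_comp1 i d2f (is_derive_expR _)) partialZ //.
by ring.
Qed.

Lemma zero_partial_segment (f : V -> R) v w :
    (forall r : R, 0 <= r <= 1 -> differentiable f (v + r *: (w - v)) /\
      forall i, partial i f (v + r *: (w - v)) = 0) ->
  f w = f v.
Proof.
move=> Hf; pose gam (r : R) := v + r *: (w - v).
have dgam (r : R) : differentiable gam r.
  have dc : differentiable (cst v : R -> V) r by exact: differentiable_cst.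
  have ds : differentiable ( *:%R^~ (w - v) : R -> V) r by exact: ex_diff.
  exact: (differentiableD dc ds).
have dF (r : R) : 0 <= r <= 1 -> is_derive r 1 (f \o gam) 0.
  move=> /Hf[df pf]; have dfg : differentiable (f \o gam) r.
    exact: differentiable_comp.
  have dd : derivable (f \o gam) r 1 by apply/derivable1_diffP.
  apply: DeriveDef => //; rewrite deriveE // diff_comp //=.
  by rewrite diff_partial // big1 // => k _; rewrite pf mulr0.
have [||c _] := @MVT _ (f \o gam) (fun=> 0) 0 1 ltr01.
- move=> r; rewrite in_itv /= => /andP[r0 r1]; apply: dF.
  by rewrite !ltW.
- apply: derivable_within_continuous => r; rewrite in_itv /= => r01.
  by have dFr := dF r r01; exact: ex_derive.
rewrite mul0r /= /gam scale0r scale1r addr0 [v + _]addrC subrK.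
by move/eqP; rewrite subr_eq0 => /eqP.
Qed.

End DifferentialCalculus.

(** * The tensors on the quotient and the LCP structure *)

Section OTTensors.
Variables (R : realType) (K : fieldExtType rat) (s t : nat).
Hypothesis s_gt0 : (0 < s)%N.
Variable sigma : 'I_(s + t + t) -> {rmorphism K -> R[i]}.
Hypothesis Hsigma : lists_embeddings sigma.
Variable U : set K.
Hypothesis HU : admissible sigma U.

Local Notation m := (s + t)%N.
Local Notation V := 'rV[R]_(m + m).
Local Notation sg i := (sigma (lshift t i)).
Local Notation HC := (@HsCt R s t).
Local Notation act := (act sigma).
Local Notation X := (OT sigma U).
Local Notation pr := (@OT_pr R K s t sigma U).
Local Notation atlas := (OT_atlas sigma U).
Local Notation J u := (multmx (fun i => sg i u)).
Implicit Types (c : chart R (m + m) X) (v w : V).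

Let oH : open HC := @HsCt_open R s t.

(** Agreement on an open set can be differentiated, which yields the Jacobian at every point of that
    set. *)
Lemma transition_local c c' v : atlas c -> atlas c' -> overlap c c' v ->
  exists u al (B : set V), [/\ U u, integer al, open B, B v & forall w, B w ->
    [/\ overlap c c' w, transition c c' w = act u al w
      & 'J (transition c c') w = J u]].
Proof.
move=> Ac Ac' ov; have [u [al [Uu ial nE]]] := transition_act s_gt0 Hsigma HU Ac Ac' ov.
pose B : set V := [set w | overlap c c' w /\ transition c c' w = act u al w]°.
have oB : open B by exact: open_interior.
have BE w : B w -> overlap c c' w /\ transition c c' w = act u al w.
  by move/interior_subset.
exists u, al, B; split=> // w Bw; have [ow tw] := BE w Bw; split=> //.
have tE : {in B, act u al =1 transition c c'}.
  by move=> z; rewrite inE => /BE[_ ->].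
have da : differentiable (act u al) w by exact: differentiable_affine.
have dt : differentiable (transition c c') w by exact: (differentiable_eq_on oB Bw tE).
rewrite -(jacobian_affine (J u) (cvec (fun i => sg i al)) w).
apply/row_matrixP => i.
apply: etrans (esym (partialE_jacobian i dt)) _.
apply: etrans _ (partialE_jacobian i da).
exact/esym/(partial_eq_on oB i Bw tE).
Qed.

Lemma OT_smooth_atlas : smooth_atlas atlas.
Proof.
split=> [x|c c' Ac Ac' k l v ov].
  have [v Hv <-] := OT_pr_surj x.
  have [c Ac cv] := OT_chart_at s_gt0 Hsigma HU Hv; exists c => //.
  by rewrite -(atlas_cinv Ac cv); exact: cinv_dom.
have [u [al [B [Uu ial oB Bv BE]]]] := transition_local Ac Ac' ov.
have lE : {in B, (fun w => act u al w 0 k) =1 (fun w => transition c c' w 0 k)}.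
  by move=> w; rewrite inE => /BE[_ -> _].
apply: (smooth_on_eq oB lE) Bv; exact: smooth_on_affine.
Qed.

Lemma OT_compact_manifold : compact_manifold atlas.
Proof.
split; first exact: OT_smooth_atlas.
- exact: (OT_hausdorff s_gt0 Hsigma HU).
- exact: OT_connected.
- exact: (OT_compact s_gt0 Hsigma HU).
Qed.

Variables (b : 'I_m -> 'cV[R]_s) (a : 'cV[R]_s) (j0 : 'I_t) (p0 : 'I_s).
Hypothesis b_real : forall i : 'I_s, b (lshift t i) = delta_mx i 0.
Hypothesis Hb : forall u (i : 'I_m), U u -> cabs (sg i u) = expR ((Ulog sigma u *m b i) 0 0).
Hypothesis aE : a = b (rshift s j0).
Hypothesis ap0 : a p0 0 < 0.

(** The chart is ignored: all charts of [OT_atlas] take their values in H^s x C^t, and compatibility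
    is invariance under the group. *)
Definition OT_metric : metric R (m + m) X := fun _ v => ot_metric b v.
Definition OT_connection : connection R (m + m) X := fun _ v => ot_christoffel b a v.
Definition OT_lee : one_form R (m + m) X := fun _ v => ot_lee a v.

Lemma OT_metric_riemannian : is_riemannian atlas OT_metric.
Proof.
split.
- move=> c Ac i j; apply: smooth_onS (smooth_on_ot_metric b i j).
  by move=> v; exact: atlas_HsCt.
- by move=> c v _ _; exact: tr_diag_mx.
- move=> c v Y _ _ Y0; rewrite /OT_metric /ot_metric mul_mx_diag mxE.
  have [k Yk] : exists k, Y 0 k != 0.
    apply/existsP; apply: contraR Y0; rewrite negb_exists => /forallP Y0.
    by apply/eqP/rowP => k; rewrite mxE; apply/eqP/negPn.
  have ge0 k' : 0 <= Y 0 k' * Emon (- (2 *: b (cindex k'))) v * Y 0 k'.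
    by rewrite mulrAC mulr_ge0 ?(ltW (Emon_gt0 _ _)) // -expr2 sqr_ge0.
  under eq_bigr do rewrite !mxE.
  rewrite (bigD1 k) //= ltr_pwDl ?sumr_ge0 // mulrAC mulr_gt0 ?Emon_gt0 //.
  by rewrite -expr2 exprn_even_gt0.
move=> c c' v Ac Ac' ov /=.
have [u [al [B [Uu ial oB Bv BE]]]] := transition_local Ac Ac' ov.
have [_ -> ->] := BE v Bv.
by apply: (ot_metric_act Hsigma HU Hb) => //; apply: (atlas_HsCt Ac); case: ov.
Qed.

Lemma OT_connection_is : is_connection atlas OT_connection.
Proof.
split.
  move=> c Ac i j k; apply: smooth_onS (smooth_on_ot_christoffel b a i j k).
  by move=> v; exact: atlas_HsCt.
move=> c c' v i Ac Ac' ov /=.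
have [u [al [B [Uu ial oB Bv BE]]]] := transition_local Ac Ac' ov.
have JE : {in B, jacobian (transition c c') =1 fun=> J u}.
  by move=> w; rewrite inE => /BE[].
rewrite (partial_eq_on oB i Bv JE) partial_cst add0r.
have [_ -> ->] := BE v Bv.
by apply: (ot_christoffel_act Hsigma HU a Hb) => //; apply: (atlas_HsCt Ac); case: ov.
Qed.

Lemma OT_connection_torsion_free : torsion_free atlas OT_connection.
Proof. by move=> c v i j k _ _; exact: ot_christoffel_sym. Qed.

(** With the connection fixed, rescaling the metric by exp (2 f) subtracts the differential of [f]
    from the Lee form. *)
Lemma conformal_lee (g : metric R (m + m) X) (f : X -> R) :
    smooth_fun atlas f ->
    (forall c v, atlas c -> ccod c v -> g c v = expR (2 * f (cinv c v)) *: OT_metric c v) ->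
  forall c v i, atlas c -> ccod c v ->
    partial i (g c) v - OT_connection c v i *m g c v
      - g c v *m (OT_connection c v i)^T
    = - (2 * (OT_lee c v i 0 - partial i (f \o cinv c) v)) *: g c v.
Proof.
move=> sf gE c v i Ac cv; have Hv := atlas_HsCt Ac cv.
have lE : {in ccod c, g c =1 fun w => expR (2 * (f \o cinv c) w) *: ot_metric b w}.
  by move=> w; rewrite inE => cw; exact: gE.
rewrite (partial_eq_on (@ccod_open _ _ _ c) i cv lE) partial_conformal; last first.
- by move=> j k; exact: (smooth_on_differentiable (smooth_on_ot_metric b j k)).
- exact: (smooth_on_differentiable (sf c Ac)).
have lincomb (P Q1 Q2 G : 'M[R]_(m + m)) (k x y : R) : P - Q1 - Q2 = - (2 * y) *: G ->
    k *: ((2 * x) *: G + P) - k *: Q1 - k *: Q2 = - (2 * (y - x)) *: (k *: G).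
  move=> /matrixP E; apply/matrixP => j l; have := E j l; rewrite !mxE => e.
  have -> : P j l = - (2 * y) * G j l + Q1 j l + Q2 j l by rewrite -e; ring.
  by ring.
rewrite gE //= /OT_metric -scalemxAr -scalemxAl.
exact: (lincomb _ _ _ _ _ _ _ (ot_lee_identity b a i Hv)).
Qed.


Definition OT_class : set (metric R (m + m) X) :=
  [set g | is_riemannian atlas g /\ conformal atlas OT_metric g].

Lemma partial_transition (f : X -> R) c c' v i : smooth_fun atlas f ->
    atlas c -> atlas c' -> overlap c c' v ->
  partial i (f \o cinv c) v =
  \sum_k 'J (transition c c') v i k * partial k (f \o cinv c') (transition c c' v).
Proof.
move=> sf Ac Ac' ov.
have [u [al [B [Uu ial oB Bv BE]]]] := transition_local Ac Ac' ov.
have lE : {in B, f \o cinv c =1 fun w => (f \o cinv c') (act u al w)}.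
  move=> w; rewrite inE => /BE[[_ c'w] tw _] /=.
  by rewrite -tw /transition /= cmapK.
have [[_ c'v] tv Jv] := BE v Bv.
rewrite (partial_eq_on oB i Bv lE) Jv tv; apply: partial_comp_affine.
rewrite -/(act u al v) -tv; apply: (smooth_on_differentiable (sf c' Ac')).
exact: cmap_cod.
Qed.

Lemma conformal_lee_form (g : metric R (m + m) X) : OT_class g ->
  exists2 f : X -> R, smooth_fun atlas f &
    lee_form atlas OT_connection g
      (fun c v => OT_lee c v - \col_i partial i (f \o cinv c) v).
Proof.
move=> [_ [f sf gE]]; exists f => //; split; last first.
  by move=> c v i Ac cv; rewrite (conformal_lee sf gE) // !mxE.
split=> [c Ac i|c c' v Ac Ac' ov].
  apply: (smooth_on_eq (@ccod_open _ _ _ c)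
    (f := fun v => OT_lee c v i 0 - partial i (f \o cinv c) v)).
    by move=> v _; rewrite !mxE.
  apply: smooth_onB; first exact: ccod_open.
    apply: smooth_onS (smooth_on_ot_lee a i).
    by move=> v; exact: atlas_HsCt.
  by apply: smooth_on_partial; exact: sf.
have [u [al [B [Uu ial oB Bv BE]]]] := transition_local Ac Ac' ov.
have [_ tv Jv] := BE v Bv; have Hv : HC v by apply: (atlas_HsCt Ac); case: ov.
rewrite mulmxBr; congr (_ - _).
  by rewrite Jv tv; exact: (ot_lee_act Hsigma HU).
apply/matrixP => i j; rewrite !mxE (partial_transition _ sf Ac Ac' ov).
by apply: eq_bigr => k _; rewrite [X in _ = _ * X]mxE.
Qed.

Lemma OT_class_metric : OT_class OT_metric.
Proof.
split; first exact: OT_metric_riemannian.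
exists (fun=> 0); first by move=> c Ac; exact: (smooth_on_cst (@ccod_open _ _ _ c) 0).
by move=> c v _ _; rewrite mulr0 expR0 scale1r.
Qed.

Lemma OT_closed_weyl : closed_weyl atlas OT_class OT_connection.
Proof.
exists OT_metric, OT_lee; split; first exact: OT_class_metric.
  split; last first.
    by move=> c v i Ac cv; apply: ot_lee_identity; exact: (atlas_HsCt Ac).
  split=> [c Ac i|c c' v Ac Ac' ov].
    apply: smooth_onS (smooth_on_ot_lee a i).
    by move=> v; exact: atlas_HsCt.
  have [u [al [B [Uu ial oB Bv BE]]]] := transition_local Ac Ac' ov.
  have [_ tv Jv] := BE v Bv; have Hv : HC v by apply: (atlas_HsCt Ac); case: ov.
  by rewrite Jv tv; exact: (ot_lee_act Hsigma HU).
move=> c v i j Ac cv; have Hv := atlas_HsCt Ac cv.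
have lE k : (fun w => OT_lee c w k 0) = dlogc a k.
  by apply: funext => w; rewrite mxE.
by rewrite !lE; exact: partial_dlogc_sym.
Qed.

(** A nonzero metric can be cancelled in the Weyl equation, so the Lee form is unique. *)
Lemma OT_metric_neq0 (g : metric R (m + m) X) c v : OT_class g -> atlas c ->
  ccod c v -> g c v != 0.
Proof.
move=> [_ [f _ gE]] Ac cv; rewrite gE //; apply/eqP => /matrixP.
move=> /(_ (yindex t p0) (yindex t p0)); rewrite !mxE eqxx mulr1n => /eqP.
by rewrite gt_eqF // mulr_gt0 ?expR_gt0.
Qed.

(* An exact Lee form would make [sum_i a_i ln y_i] descend to the quotient up to
   a constant, so that [a] would vanish on the lattice of [U]. *)
Lemma OT_not_exact : ~ exact_weyl atlas OT_class OT_connection.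
Proof.
move=> [g [th [Cg [_ thE] [h sh thh]]]].
have [f sf [_ leeE]] := conformal_lee_form Cg.
have dE c v i : atlas c -> ccod c v ->
    dlogc a i v = partial i (f \o cinv c) v + partial i (h \o cinv c) v.
  move=> Ac cv; have := etrans (esym (thE c v i Ac cv)) (leeE c v i Ac cv).
  move/eqP; rewrite -subr_eq0 -scalerBl scaler_eq0 (negPf (OT_metric_neq0 Cg Ac cv)) orbF.
  rewrite !mxE thh // => /eqP; lra.
(* [f] is the conformal exponent of [g] and [h] the assumed primitive; [Psi] has zero differential
   on the convex cover. *)
pose F (x : X) := f x + h x; pose Psi v := logc a v - F (pr v).
have PsiP v : HC v -> differentiable Psi v /\ forall i, partial i Psi v = 0.
  move=> Hv; have [c Ac cv] := OT_chart_at s_gt0 Hsigma HU Hv.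
  have lE : {in ccod c, (fun w => logc a w - ((f \o cinv c) w + (h \o cinv c) w)) =1 Psi}.
    by move=> w; rewrite inE => cw; rewrite /Psi /F /= (atlas_cinv Ac cw).
  have df := smooth_on_differentiable (sf c Ac) cv.
  have dh := smooth_on_differentiable (sh c Ac) cv.
  have da := differentiable_logc a Hv.
  have dfh := differentiableD df dh.
  split=> [|i].
    apply: (differentiable_eq_on (@ccod_open _ _ _ c) cv lE).
    exact: (differentiableB da dfh).
  rewrite -(partial_eq_on (@ccod_open _ _ _ c) i cv lE).
  apply: etrans (deriveB (diff_derivable da) (diff_derivable dfh)) _.
  rewrite -/(partial i (logc a) v) partial_logc // (dE c) //.
  by rewrite -(partialD i df dh); exact: subrr.
have Psi_cst v w : HC v -> HC w -> Psi w = Psi v.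
  move=> Hv Hw; apply: zero_partial_segment => r r01; apply: PsiP.
  exact: HsCt_segment.
(* A point and its translate have the same projection, so only the change of [logc a] remains in
   [Psi]. *)
have Ua u : U u -> Ulog sigma u *m a = 0.
  move=> Uu; have Hz := @HsCt_ptP R s t; have Ha := act_HsCt Hsigma HU 0 Uu Hz.
  have := Psi_cst _ _ Hz Ha; rewrite /Psi (OT_pr_act Hsigma HU) //; last exact: integer_int 0.
  move/addIr; rewrite /logc (logy_act Hsigma HU) // mulmxDl mxE.
  move/eqP; rewrite -subr_eq0 addrK => /eqP E.
  by apply/matrixP => i j; rewrite !ord1 E mxE.
have UL : full_lattice [set lsubmx (ell sigma u) | u in U] by case: HU.
have : a = 0 by apply: (lattice_span UL) => _ [u Uu <-]; exact: Ua.
by move=> a0; move: ap0; rewrite a0 mxE ltxx.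
Qed.

Definition flat_coord (l : 'I_(m + m)) := cindex l == rshift s j0.

(* The invariant subspace used for reducibility is the orthogonal complement of
   the flat factor: the columns of the connection matrices at the flat
   coordinates vanish, so no uniqueness theorem for linear ODEs is needed. *)
Lemma transport_flat c v c' v' P : transport atlas OT_connection c v c' v' P ->
  forall Y : V, (forall l, flat_coord l -> Y 0 l = 0) ->
  forall l, flat_coord l -> (Y *m P) 0 l = 0.
Proof.
elim=> {c v c' v' P} [c c' v Ac Ac' ov|c gam P Ac gam_smooth gam_c P0 dP|
    c v c' v' c'' v'' P Q _ IHP _ IHQ] Y Y0 l fl.
- have [u [al [B [Uu ial oB Bv BE]]]] := transition_local Ac Ac' ov.
  have [_ _ ->] := BE v Bv; rewrite mxE big1 // => k _.
  have [kl|kl] := eqVneq (cindex k) (cindex l); last by rewrite multmx_eq0 ?mulr0.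
  by rewrite Y0 ?mul0r // /flat_coord kl.
(* By [ot_christoffel_col0] the transport equation gives this column a zero derivative. *)
- have colE k : P 1 k l = P 0 k l.
    have dPkl (r : R) : 0 <= r <= 1 -> is_derive r 1 (fun q => P q k l) 0.
      move=> r01; have dPr := dP r r01.
      have dr : derivable P r 1 by exact: ex_derive.
      have drkl : derivable (fun q => P q k l) r 1 by move/derivable_mxP: dr.
      apply: DeriveDef => //; have := @derive_val _ _ _ _ _ _ _ dPr.
      rewrite derive_mx // => /matrixP/(_ k l); rewrite mxE => ->.
      rewrite !mxE big1 ?oppr0 // => q _; rewrite summxE big1 ?mulr0 // => i _.
      by rewrite mxE (ot_christoffel_col0 _ _ _ aE) ?mulr0 //; exact/eqP.
    have [||q _] := @MVT _ (fun q => P q k l) (fun=> 0) 0 1 ltr01.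
    + by move=> r; rewrite in_itv /= => /andP[r0 r1]; apply: dPkl; rewrite !ltW.
    + apply: derivable_within_continuous => r; rewrite in_itv /= => r01.
      by have dr := dPkl r r01; exact: ex_derive.
    by move/eqP; rewrite mul0r subr_eq0 => /eqP.
  rewrite mxE; under eq_bigr do rewrite colE P0.
  have -> : \sum_k Y 0 k * (1%:M : 'M[R]_(m + m)) k l = (Y *m 1%:M) 0 l by rewrite mxE.
  by rewrite mulmx1 Y0.
- by rewrite mulmxA; apply: IHQ => // k fk; exact: IHP.
Qed.

Lemma OT_reducible : reducible atlas OT_connection.
Proof.
move=> c v Ac cv.
(* The row space is spanned by the nonflat directions: it contains that of y_p0 and misses those of
   z_(s+j0). *)
pose W : 'M[R]_(m + m) := diag_mx (\row_l (~~ flat_coord l)%:R).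
have Wl k l : flat_coord l -> W k l = 0.
  by move=> fl; rewrite !mxE; have [->|_] := eqVneq k l; rewrite ?fl ?mulr0n.
exists W; split; last first.
  move=> P trP; apply/submxP; exists (W *m P).
  apply/matrixP => k l; rewrite [in RHS]mul_mx_diag [RHS]mxE [X in _ = _ * X]mxE.
  have [fl|fl] := boolP (flat_coord l); last by rewrite mulr1.
  rewrite mulr0; have := transport_flat trP (Y := row k W).
  rewrite -row_mul => /(_ _ l fl); rewrite mxE; apply => q fq.
  by rewrite mxE Wl.
apply/andP; split.
  rewrite lt0n mxrank_eq0; apply/eqP => /matrixP.
  pose x := yindex t p0; move=> /(_ x x); rewrite !mxE eqxx mulr1n.
  rewrite /flat_coord cindex_yindex eq_lrshift => /eqP.
  by rewrite oner_eq0.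
rewrite ltn_neqAle rank_leq_row andbT; apply/negP => rW.
have uW : W \in unitmx by rewrite -row_free_unit.
pose l := lshift m (rshift s j0).
have fl : flat_coord l by rewrite /flat_coord cindexl.
have : W *m (delta_mx l 0 : 'cV[R]_(m + m)) = 0.
  by rewrite -colE; apply/matrixP => k j; rewrite mxE Wl // mxE.
move/(congr1 (mulmx (invmx W))); rewrite mulKmx // mulmx0 => /matrixP/(_ l 0).
by rewrite !mxE !eqxx => /eqP; rewrite oner_eq0.
Qed.

Lemma OT_not_flat : ~ flat atlas OT_connection.
Proof.
have [c Ac cv] := OT_chart_at s_gt0 Hsigma HU (@HsCt_ptP R s t).
move=> /(_ c _ (xindex t p0) (yindex t p0) Ac cv)/matrixP/(_ (xindex t p0) (yindex t p0)).
rewrite [RHS]mxE; apply/eqP.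
exact: (ot_curvature_pt b_real ap0).
Qed.

Lemma OT_lcp_structure : lcp_structure atlas OT_class OT_connection.
Proof.
split; last by split; [exact: OT_reducible | exact: OT_not_flat].
split.
- exact: OT_compact_manifold.
- by exists OT_metric => //; exact: OT_metric_riemannian.
- split; [exact: OT_connection_is | exact: OT_connection_torsion_free |].
  by move=> g /conformal_lee_form[f _ lee]; eexists; exact: lee.
- exact: OT_closed_weyl.
- exact: OT_not_exact.
Qed.

End OTTensors.
Theorem corollary4p6 (R : realType) (K : fieldExtType rat) (s t : nat)
    (s_gt0 : (0 < s)%N) (t_gt0 : (0 < t)%N)
    (sigma : 'I_(s + t + t) -> {rmorphism K -> R[i]})
    (Hsigma : lists_embeddings sigma)
    (U : set K) (HU : admissible sigma U) :
  exists (C : set (metric R (s + t + (s + t)) (OT sigma U)))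
         (D : connection R (s + t + (s + t)) (OT sigma U)),
    lcp_structure (OT_atlas sigma U) C D.
Proof.
have [b [b_real Hb]] := cabs_exponents s_gt0 Hsigma HU.
have [j [p bp]] := negative_exponent s_gt0 Hsigma HU b_real Hb.
do 2 eexists; exact: (OT_lcp_structure s_gt0 Hsigma HU b_real Hb erefl bp).
Qed.
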